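(* Let $n > 2$ and let $A = (a_{ij}) \in \mathbb{Z}^{2\times n}$ be a faithful completely generic weight matrix with $2\times 2$ minors $d_{ij} = a_{1i}a_{2j} - a_{2i}a_{1j}$. Then, for complex $t$ with $0<|t|<1$, the Hilbert series $\operatorname{Hilb}_A^{\mathit{on}}(t)$ is given by $$\operatorname{Hilb}_A^{\mathit{on}}(t) = \sum_{\substack{i\neq j \\ d_{ij} > 0}} \ \sum_{\substack{\xi^{d_{ij}}=1 \\ \zeta^{d_{ij}} = 1}} \frac{1}{d_{ij}^2 \prod\limits_{k\neq i,j} \big(1 - \xi^{d_{ik}} \zeta^{d_{jk}} t^{(d_{ij} + d_{ik} + d_{jk})/d_{ij}} \big)\big(1 - \xi^{-d_{ik}} \zeta^{-d_{jk}} t^{(d_{ij} - d_{ik} - d_{jk})/d_{ij}} \big)},$$ where the outer sum is over ordered pairs $(i,j)$ of distinct indices in $\{1,\dots,n\}$ with $d_{ij}>0$, the inner sum is over all pairs $(\xi,\zeta)$ of complex $d_{ij}$th roots of unity, the product is over $k\in\{1,\dots,n\}\setminus\{i,j\}$, and fractional powers of $t$ are computed with one fixed choice of $\log t$ (the result does not depend on this choice).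
   Context: A weight matrix $A=(a_{ij})\in\mathbb{Z}^{2\times n}$ defines the unitary representation $V=V_A\cong\mathbb{C}^n$ of the torus $\mathbb{T}^2$ by $(z_1,z_2)\cdot(x_1,\ldots,x_n) = (z_1^{a_{11}}z_2^{a_{21}}x_1,\ldots,z_1^{a_{1n}}z_2^{a_{2n}}x_n)$. Let $\mathbb{R}[V]^{\mathbb{T}^2}$ be the algebra of real-valued $\mathbb{T}^2$-invariant real polynomial functions on the underlying real vector space of $V$, graded by polynomial degree. The moment map has components $J_i(x) = \frac12\sum_{j=1}^n a_{ij}x_j\overline{x_j}$, $i=1,2$. Let $I_J$ be the ideal of $\mathbb{R}[V]$ generated by $J_1,J_2$ and $I_J^{\mathbb{T}^2} = I_J\cap\mathbb{R}[V]^{\mathbb{T}^2}$. The Hilbert series of a graded algebra $R=\bigoplus_{d\ge0}R_d$ over a field is $\sum_d t^d\dim R_d$, and $\operatorname{Hilb}_A^{\mathit{on}}(t)$ denotes the Hilbert series of the graded algebra $\mathbb{R}[V]^{\mathbb{T}^2}/I_J^{\mathbb{T}^2}$. $A$ is faithful if $\operatorname{rank}A=2$ and the gcd of all $2\times2$ minors $d_{ij}$ is $1$. $A$ is in standard form if $a_{1i}>0$ for every $i$. $A$ is generic if it is in standard form, $a_{1i}\neq a_{1j}$ for $i\ne j$, and $d_{ij}+d_{ik}+d_{jk}\neq0$ for all distinct $i,j,k$ (all orderings). $A$ is completely generic if it is generic and moreover $d_{ij}+d_{jk}+d_{ki}\neq 0$ for all distinct $i,j,k$. *)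

(* Defs.v *)
From HB Require Import structures.
(* mpoly has to be imported before normedtype: their notations clash in the
   other order. *)
From mathcomp Require Import all_boot all_order all_algebra.
From mathcomp Require Import mpoly complex boolp classical_sets functions.
From mathcomp Require Import cardinality fsbigop reals topology normedtype.
From mathcomp Require Import sequences exp trigo.

Set Implicit Arguments.
Unset Strict Implicit.
Unset Printing Implicit Defensive.

Import Order.TTheory GRing.Theory Num.Theory numFieldNormedType.Exports.

Local Open Scope ring_scope.
Local Open Scope classical_set_scope.
Local Open Scope complex_scope.

Section QuotientDimension.
Variables (K : fieldType) (V : lmodType K).
Implicit Types U W : set V.

(* The classes modulo W of the k vectors b_i form a basis of the image of U
   in V / W, i.e. of U / (U `&` W). *)
Definition quot_basis U W k (b : 'I_k -> V) : Prop :=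
  (forall i, U (b i)) /\
  forall u, U u -> exists! c : 'rV[K]_k, W (u - \sum_i c 0 i *: b i).

(* The junk value 0 is only taken when the quotient is infinite-dimensional;
   see quot_dimP, quot_dim_eq and hilb_onP below. *)
Definition quot_dim U W : nat :=
  xget 0%N [set k | exists b : 'I_k -> V, quot_basis U W b].

Definition subspace U : Prop :=
  U 0 /\ forall (a : K) u v, U u -> U v -> U (a *: u + v).

Lemma subspace_sum U k (c : 'I_k -> K) (b : 'I_k -> V) :
  subspace U -> (forall i, U (b i)) -> U (\sum_i c i *: b i).
Proof.
move=> [U0 UD] Ub; elim: (index_enum _) => [|i s IH]; first by rewrite big_nil.
by rewrite big_cons; apply: UD.
Qed.

Lemma subspaceB U u v : subspace U -> U u -> U v -> U (u - v).
Proof. by move=> [_ UD] Uu Uv; rewrite addrC -scaleN1r; apply: UD. Qed.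

Lemma quot_basis_free U W k (b : 'I_k -> V) (c : 'rV[K]_k) :
  subspace U -> subspace W -> quot_basis U W b ->
  W (\sum_i c 0 i *: b i) -> c = 0.
Proof.
move=> sU sW [_ /(_ 0 sU.1) [c0 [_ uc]]] Wc.
have W0 : W (0 - \sum_i (0 : 'rV[K]_k) 0 i *: b i).
  by rewrite big1 ?subr0 => [|i _]; [exact: sW.1 | rewrite mxE scale0r].
have WNc : W (0 - \sum_i (- c) 0 i *: b i).
  rewrite sub0r -sumrN.
  rewrite (eq_bigr (fun i => c 0 i *: b i)) // => i _.
  by rewrite mxE scaleNr opprK.
by rewrite -[c]opprK -(uc _ WNc) (uc _ W0) oppr0.
Qed.

Lemma kernel_vector k l (M : 'M[K]_(k, l)) :
  (l < k)%N -> exists2 c : 'rV[K]_k, c != 0 & c *m M = 0.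
Proof.
move=> lk; have /rowV0Pn [v vK v0] : kermx M != 0.
  by rewrite kermx_eq0 -row_leq_rank -ltnNge (leq_ltn_trans (rank_leq_col M)).
by exists v => //; apply/sub_kermxP.
Qed.

Lemma quot_basis_leq U W k l (b : 'I_k -> V) (b' : 'I_l -> V) :
  subspace U -> subspace W -> quot_basis U W b -> quot_basis U W b' ->
  (k <= l)%N.
Proof.
move=> sU sW Bb Bb'; rewrite leqNgt; apply/negP => lk.
have /choice [f fP] i : exists c : 'rV[K]_l, W (b i - \sum_j c 0 j *: b' j).
  by have [c [Wc _]] := Bb'.2 _ (Bb.1 i); exists c.
have [c c0 cM] := kernel_vector (\matrix_i f i) lk.
move/eqP: c0; apply; apply: (quot_basis_free sU sW Bb).
have := subspace_sum (fun i => c 0 i) sW fP.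
congr (W _); rewrite (eq_bigr _ (fun i _ => scalerBr _ _ _)) sumrB.
rewrite [X in _ - X](_ : _ = 0) ?subr0 //.
under eq_bigr do rewrite scaler_sumr.
rewrite exchange_big /= big1 // => j _.
under eq_bigr do rewrite scalerA.
rewrite -scaler_suml.
move/matrixP/(_ 0 j): cM; rewrite !mxE => cMj.
rewrite [X in X *: _](_ : _ = 0) ?scale0r // -[RHS]cMj.
by apply: eq_bigr => i _; rewrite mxE.
Qed.

Lemma quot_dim_eq U W k (b : 'I_k -> V) :
  subspace U -> subspace W -> quot_basis U W b -> quot_dim U W = k.
Proof.
move=> sU sW Bb; rewrite /quot_dim; case: xgetP => [l _ [b' Bb']|/(_ k) H].
  by apply/eqP; rewrite eqn_leq (quot_basis_leq sU sW Bb' Bb)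
    (quot_basis_leq sU sW Bb Bb').
by case: H; exists b.
Qed.

(* N linear functionals separating the points of U witness that U is
   finite-dimensional. *)
Lemma quot_dimP U W N (phi : V -> 'rV[K]_N) :
  subspace U -> subspace W ->
  (forall a u v, phi (a *: u + v) = a *: phi u + phi v) ->
  (forall u, U u -> phi u = 0 -> u = 0) ->
  exists b : 'I_(quot_dim U W) -> V, quot_basis U W b.
Proof.
move=> sU sW phiD phi_inj.
pose indep k (b : 'I_k -> V) := (forall i, U (b i)) /\
  forall c : 'rV[K]_k, W (\sum_i c 0 i *: b i) -> c = 0.
pose P k := `[< exists b : 'I_k -> V, indep k b >].
have phi0 : phi 0 = 0.
  by have := phiD (-1) 0 0; rewrite scaler0 addr0 scaleN1r addNr.
have phi_sum k (c : 'I_k -> K) (b : 'I_k -> V) :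
    phi (\sum_i c i *: b i) = \sum_i c i *: phi (b i).
  elim: (index_enum _) => [|i s IH]; first by rewrite !big_nil.
  by rewrite !big_cons phiD IH.
have P0 : exists k, P k.
  exists 0%N; apply/asboolP; exists (fun=> 0); split=> [i|c _]; first exact: sU.1.
  by apply/rowP => -[].
have Pbd k : P k -> (k <= N)%N.
  move=> /asboolP [b [Ub free_b]]; rewrite leqNgt; apply/negP => lk.
  have [c c0 cM] := kernel_vector (\matrix_i phi (b i)) lk.
  move/eqP: c0; apply; apply: free_b.
  rewrite [X in W X](_ : _ = 0); first exact: sW.1.
  apply: phi_inj; first exact: subspace_sum.
  rewrite phi_sum -[RHS]cM mulmx_sum_row; apply: eq_bigr => i _.
  by rewrite rowK.
have [k /asboolP [b [Ub free_b]] kmax] := ex_maxnP P0 Pbd.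
have Bb : quot_basis U W b.
  split=> // u Uu.
  have [c Wc] : exists c : 'rV[K]_k, W (u - \sum_i c 0 i *: b i).
    apply: contrapT => Nc.
    suff /kmax : P k.+1 by rewrite ltnn.
    apply/asboolP.
    exists (fun i => if unlift ord0 i is Some j then b j else u); split.
      by move=> i; case: unliftP.
    move=> c; rewrite big_ord_recl unlift_none.
    under eq_bigr do rewrite liftK.
    have [c00|c00] := eqVneq (c 0 ord0) 0; last first.
      move=> Wc; case: Nc.
      exists (\row_i (- (c 0 ord0)^-1 * c 0 (lift ord0 i))).
      have := sW.2 (c 0 ord0)^-1 _ _ Wc sW.1.
      congr (W _); rewrite addr0 scalerDr scalerA mulVf // scale1r; congr (_ + _).
      rewrite scaler_sumr -sumrN; apply: eq_bigr => i _.
      by rewrite mxE mulNr scaleNr opprK scalerA.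
    rewrite c00 scale0r add0r => Wc.
    have c'0 : \row_i c 0 (lift ord0 i) = 0.
      apply: free_b; move: Wc; congr (W _).
      by apply: eq_bigr => i _; rewrite mxE.
    apply/rowP => i; rewrite !mxE; case: (unliftP ord0 i) => [j|] -> //.
    by move/rowP/(_ j): c'0; rewrite !mxE.
  exists c; split=> // c' Wc'; apply/eqP; rewrite -subr_eq0; apply/eqP.
  apply: free_b; have := subspaceB sW Wc' Wc; congr (W _).
  rewrite opprB addrC addrA subrK -sumrB.
  by apply: eq_bigr => i _; rewrite !mxE scalerBl.
by rewrite (quot_dim_eq sU sW Bb); exists b.
Qed.

End QuotientDimension.

Section WeightMatrix.
Variables (n : nat) (A : 'M[int]_(2, n)).

Definition minor (i j : 'I_n) : int := A 0 i * A 1 j - A 1 i * A 0 j.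

Definition faithful : Prop :=
  \rank (map_mx (intr : int -> rat) A) = 2%N /\
  \big[gcdz/0]_(i < n) \big[gcdz/0]_(j < n) minor i j = 1.

Definition standard_form : Prop := forall i, 0 < A 0 i.

Definition generic : Prop :=
  [/\ standard_form,
      forall i j, i != j -> A 0 i != A 0 j &
      forall i j k, i != j -> i != k -> j != k ->
        minor i j + minor i k + minor j k != 0].

Definition completely_generic : Prop :=
  generic /\
  forall i j k, i != j -> i != k -> j != k ->
    minor i j + minor j k + minor k i != 0.

End WeightMatrix.

Section SymplecticQuotient.
Variables (R : realType) (n : nat) (A : 'M[int]_(2, n)).

Definition torus2 (z : R[i] * R[i]) : Prop := `|z.1| = 1 /\ `|z.2| = 1.

Definition torus_act (z : R[i] * R[i]) (x : 'rV[R[i]]_n) : 'rV[R[i]]_n :=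
  \row_j (z.1 ^ A 0 j * z.2 ^ A 1 j * x 0 j).

(* R[V] is {mpoly R[n + n]}: variable lshift n j is the real part of the j-th
   coordinate x_j, and variable rshift n j is its imaginary part. *)
Definition real_coord (x : 'rV[R[i]]_n) (k : 'I_(n + n)) : R :=
  match fintype.split k with
  | inl j => complex.Re (x 0 j)
  | inr j => complex.Im (x 0 j)
  end.

Definition poly_fun (p : {mpoly R[n + n]}) (x : 'rV[R[i]]_n) : R :=
  p.@[real_coord x].

Definition invariants : set {mpoly R[n + n]} :=
  [set p | forall z x, torus2 z -> poly_fun p (torus_act z x) = poly_fun p x].

(* x_j * conj x_j = Re(x_j)^2 + Im(x_j)^2; see moment_mapE. *)
Definition moment_map (i : 'I_2) : {mpoly R[n + n]} :=
  2^-1 *: \sum_(j < n) (A i j)%:~R *: ('X_(lshift n j) ^+ 2 + 'X_(rshift n j) ^+ 2).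

Lemma moment_mapE (i : 'I_2) (x : 'rV[R[i]]_n) :
  (poly_fun (moment_map i) x)%:C =
  2^-1 * \sum_(j < n) (A i j)%:~R * (x 0 j * (x 0 j)^*).
Proof.
rewrite /poly_fun /moment_map mevalZ rmorphM /= fmorphV rmorph_nat.
congr (_ * _); rewrite (raddf_sum (meval (real_coord x))) raddf_sum; apply: eq_bigr => j _ /=.
rewrite mevalZ rmorphM /= rmorph_int; congr (_ * _).
rewrite mevalD !rmorphXn /= !mevalXU /real_coord.
rewrite -[lshift n j]/(unsplit (inl j)) -[rshift n j]/(unsplit (inr j)) !unsplitK.
case: (x 0 j) => a b /=; apply/eqP; rewrite eq_complex /= mulrN opprK.
by rewrite -!expr2 mulrN [b * a]mulrC addNr !eqxx.
Qed.

(* The ideal I_J of R[V] generated by J_1 and J_2. *)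
Definition shell_ideal : set {mpoly R[n + n]} :=
  [set p | exists q : 'I_2 -> {mpoly R[n + n]}, p = \sum_i q i * moment_map i].

Definition shell_ideal_inv : set {mpoly R[n + n]} := shell_ideal `&` invariants.

(* Dimension of the degree-d component of R[V]^T / I_J^T, i.e. of the image in
   that quotient of the invariants that are homogeneous of degree d. *)
Definition hilb_on (d : nat) : nat :=
  quot_dim (invariants `&` [set p | p \is d.-homog]) shell_ideal_inv.

Lemma invariants_subspace : subspace invariants.
Proof.
split=> [z x _|a u v Iu Iv z x Tz]; first by rewrite /poly_fun !meval0.
rewrite /poly_fun !mevalD !mevalZ.
by have := Iu z x Tz; have := Iv z x Tz; rewrite /poly_fun => -> ->.
Qed.

Lemma shell_ideal_inv_subspace : subspace shell_ideal_inv.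
Proof.
have [I0 ID] := invariants_subspace; split.
  by split=> //; exists (fun=> 0); rewrite big1 // => i _; rewrite mul0r.
move=> a u v [[q ->] Iu] [[q' ->] Iv]; split; last exact: ID.
exists (fun i => a *: q i + q' i).
rewrite scaler_sumr -big_split /=; apply: eq_bigr => i _.
by rewrite mulrDl scalerAl.
Qed.

Lemma hilb_onP (d : nat) :
  exists b : 'I_(hilb_on d) -> {mpoly R[n + n]},
    quot_basis (invariants `&` [set p | p \is d.-homog]) shell_ideal_inv b.
Proof.
pose M : finType := bmultinom (n + n) d.+1.
pose phi (p : {mpoly R[n + n]}) : 'rV[R]_#|M| :=
  \row_i p@_(bmnm (enum_val i : M)).
apply: (quot_dimP (phi := phi)).
- have [I0 ID] := invariants_subspace; split.
    by split=> //=; exact: dhomog0.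
  move=> a u v [Iu du] [Iv dv]; split; first exact: ID.
  by rewrite /= rpredD ?rpredZ.
- exact: shell_ideal_inv_subspace.
- by move=> a u v; apply/rowP => i; rewrite !mxE mcoeffD mcoeffZ.
- move=> u [_ /= du] u0; apply/mpolyP => m; rewrite mcoeff0.
  have [md|md] := eqVneq (mdeg m) d; last exact: (dhomog_nemf_coeff du).
  have mlt : (mdeg m < d.+1)%N by rewrite md.
  have /rowP/(_ (enum_rank (BMultinom mlt : M))) := u0.
  by rewrite !mxE enum_rankK.
Qed.

End SymplecticQuotient.

Definition cexp (R : realType) (z : R[i]) : R[i] :=
  (expR (complex.Re z))%:C * (cos (complex.Im z) +i* sin (complex.Im z)).

(* The power t ^ (m / d), computed with the logarithm logt of t. *)
Definition cpow_frac (R : realType) (logt : R[i]) (m d : int) : R[i] :=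
  cexp (m%:~R / d%:~R * logt).

(* Main.v *)
(* Over the complex numbers, in the coordinates z_j = x_j and w_j = conj x_j, the
   invariants are spanned by the monomials z^a w^b with A (a - b) = 0, and
   J_1, J_2 become the quadrics sum_j a_ij z_j w_j, which form a regular sequence.
   Splitting off the common factor of z^a and w^b, one gets
     Hilb(t) = (1 - t^2)^(2 - n) sum_g t^|g|_1,   g in ker A.
   By Molien's formula the sum over ker A is an integral of a product of Poisson
   kernels over the torus, to be computed by iterated residues. Moving the contour
   |z| = |t|^y, first along y = (s, 0) and then along the lines <y, a_j> = 1, changes
   the expansion of one factor at a time, so that the residue theorem becomes an
   identity of Laurent polynomials in t for each single g in ker A:
     t^|g|_1 = sum_(d_ij > 0) t^(g_i - g_j) prod_(k <> i, j) p_k(g_k),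
   where p_k(m) is the coefficient of X^m in the expansion of the Poisson kernel valid
   at the crossing point of <y, a_i> = -1 and <y, a_j> = 1. Averaging over the roots
   of unity xi and zeta selects the integral points of ker A among all values of the
   (g_k) with k <> i, j, and the sum over g factors into geometric series. *)

Require Import Defs.
From mathcomp Require Import all_boot all_order all_algebra.
From mathcomp Require Import mpoly complex boolp classical_sets functions.
From mathcomp Require Import cardinality fsbigop reals topology normedtype.
From mathcomp Require Import sequences exp trigo.
From mathcomp Require Import zify ring lra.
From mathcomp Require separable cyclotomic.

Import Order.TTheory GRing.Theory Num.Theory numFieldNormedType.Exports.

Local Open Scope ring_scope.
Local Open Scope classical_set_scope.
Local Open Scope complex_scope.

Set Implicit Arguments.
Unset Strict Implicit.
Unset Printing Implicit Defensive.

Local Notation subspace := Defs.subspace.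

(** * Jumps of products of step functions *)

(** For one fixed g, two facts make the contour move formal. Far out on a path, the factor moving
    with speed c_k is supported on exponents with c_k g_k > 0, while sum_k c_k g_k = 0 because the
    speeds combine the rows of A; so the product of kernels vanishes there, and its value at the
    start is minus the sum of the jumps. Moreover no other factor may sit on a pole at a jump: on
    the ray (s, 0) this is the distinctness of the entries of the first row, on <y, a_j> = 1 it says
    that this line and two lines <y, a_k> = 1 or -1, <y, a_l> = 1 or -1 have no common point, which
    is what the conditions on minors express. The obstacle in summing over g is the order of
    summation. The Hilbert series exhausts ker A by l1-balls, whereas the geometric series of a pair
    (i, j) need boxes in the coordinates other than i, j, hence boxes that change with the pair. A
    bound |tau|^|g_k| on each factor, with tau a d_ij-th root of t, gives absolute convergence and
    makes both exhaustions equivalent. Finally, the n - 2 numerators 1 - t^2 of the Poisson kernels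
    cancel the prefactor (1 - t^2)^(2 - n). *)

Lemma step_mul (F : comRingType) (A B : eqType) (ra : seq A) (rb : seq B)
    (T : A -> rat) (U : B -> rat) (J : A -> F) (K : B -> F) (v w : F) (s : rat) :
  (forall a b, a \in ra -> b \in rb -> T a = U b -> J a * K b = 0) ->
  (v + \sum_(a <- ra) (T a < s)%R%:R * J a) *
  (w + \sum_(b <- rb) (U b < s)%R%:R * K b) =
  v * w +
  \sum_(a <- ra) (T a < s)%R%:R * (J a * (w + \sum_(b <- rb) (U b < T a)%R%:R * K b)) +
  \sum_(b <- rb) (U b < s)%R%:R * (K b * (v + \sum_(a <- ra) (T a < U b)%R%:R * J a)).
Proof.
move=> TU.
(* A pair of jumps is credited to the later one, at which the other has already happened;
   simultaneous pairs drop out by [TU]. *)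
have E : (\sum_(a <- ra) (T a < s)%R%:R * J a) * (\sum_(b <- rb) (U b < s)%R%:R * K b) =
  \sum_(a <- ra) \sum_(b <- rb) (T a < s)%R%:R * (J a * ((U b < T a)%R%:R * K b)) +
  \sum_(a <- ra) \sum_(b <- rb) (U b < s)%R%:R * (K b * ((T a < U b)%R%:R * J a)).
  rewrite mulr_suml -big_split /=; apply: eq_big_seq => a ar.
  rewrite mulr_sumr -big_split /=; apply: eq_big_seq => b br.
  have [TsU|UsT|/(TU a b ar br) JK] := ltgtP (T a) (U b).
  - case: (ltP (U b) s) => [Us|sU]; last by rewrite !(mul0r, mulr0, addr0).
    by rewrite (lt_trans TsU Us) !mul1r !(mul0r, mulr0, add0r) mulrC.
  - case: (ltP (T a) s) => [Ts|sT]; last by rewrite !(mul0r, mulr0, addr0).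
    by rewrite (lt_trans UsT Ts) !mul1r !(mul0r, mulr0, addr0).
  by rewrite mulrACA JK !(mul0r, mulr0, addr0).
rewrite mulrDl !mulrDr E.
rewrite [X in _ + (_ + (_ + X))]exchange_big /=.
have -> : \sum_(a <- ra) (T a < s)%R%:R *
    (J a * (w + \sum_(b <- rb) (U b < T a)%R%:R * K b)) =
  (\sum_(a <- ra) (T a < s)%R%:R * J a) * w +
  \sum_(a <- ra) \sum_(b <- rb) (T a < s)%R%:R * (J a * ((U b < T a)%R%:R * K b)).
  rewrite mulr_suml -big_split /=; apply: eq_bigr => a _.
  by rewrite -!mulr_sumr !mulrDr mulrA.
have -> : \sum_(b <- rb) (U b < s)%R%:R *
    (K b * (v + \sum_(a <- ra) (T a < U b)%R%:R * J a)) =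
  v * (\sum_(b <- rb) (U b < s)%R%:R * K b) +
  \sum_(b <- rb) \sum_(a <- ra) (U b < s)%R%:R * (K b * ((T a < U b)%R%:R * J a)).
  rewrite mulr_sumr -big_split /=; apply: eq_bigr => a _.
  by rewrite -!mulr_sumr !mulrDr mulrA [v * _]mulrC mulrA.
ring.
Qed.

(** A discrete Leibniz rule: at a jump of one factor the others contribute their current value.
    Simultaneous jumps need only have product zero, because a constant factor has zero jumps placed
    at meaningless times. *)
Lemma step_prod (F : comRingType) (I : eqType) (E : finType) (r : seq I)
    (T : I -> E -> rat) (J : I -> E -> F) (v : I -> F) (s : rat) :
  let f k s := v k + \sum_e (T k e < s)%R%:R * J k e in
  uniq r ->
  (forall k l e e', k \in r -> l \in r -> k != l -> T k e = T l e' ->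
     J k e * J l e' = 0) ->
  \prod_(k <- r) f k s = \prod_(k <- r) v k +
  \sum_(k <- r) \sum_e (T k e < s)%R%:R *
     (J k e * \prod_(l <- r | l != k) f l (T k e)).
Proof.
move=> f; elim: r s => [|k0 r IH] s /=; first by rewrite !big_nil addr0.
move=> /andP[k0r ur] H.
have H' k l e e' : k \in r -> l \in r -> k != l -> T k e = T l e' ->
     J k e * J l e' = 0.
  by move=> kr lr; apply: H; rewrite inE ?kr ?lr orbT.
have neq k : k \in r -> k != k0 by apply: contraTneq => ->.
rewrite !big_cons (IH _ ur H').
have allE s' : \sum_(k <- r) \sum_e (T k e < s')%R%:R *
     (J k e * \prod_(l <- r | l != k) f l (T k e)) =
   \sum_(b <- [seq (k, e) | k <- r, e <- index_enum E]) (T b.1 b.2 < s')%R%:R *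
     (J b.1 b.2 * \prod_(l <- r | l != b.1) f l (T b.1 b.2)).
  by rewrite big_allpairs_dep.
rewrite allE step_mul; last first.
  move=> a [k e] _ /allpairsP[[k' e'] /= [k'r _ [-> ->]]] TT.
  by rewrite mulrA (H k0 k' a e') ?mul0r ?inE ?eqxx ?k'r ?orbT // eq_sym neq.
rewrite -addrA; congr (_ + (_ + _)).
  apply: eq_bigr => a _; rewrite big_cons eqxx /=.
  rewrite -allE -(IH _ ur H'); congr (_ * (_ * _)).
  rewrite big_seq [RHS]big_seq_cond; apply: eq_bigl => l.
  by case lr: (l \in r) => //=; rewrite neq.
rewrite big_allpairs_dep /=.
apply: eq_big_seq => k kr; apply: eq_bigr => e _.
by rewrite big_cons eq_sym neq // -mulrA [_ * f _ _]mulrC.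
Qed.

(** * Crossing the poles of Poisson kernels *)

(* The coefficient of X^m in the expansion of the Poisson kernel
   (1 - t^2) / ((1 - t X) (1 - t / X)) on the circle |X| = |t|^x; it jumps when x
   crosses one of the poles x = -1 and x = 1. *)
Definition pkernel (F : fieldType) (t : F) (x : rat) (m : int) : F :=
  (if (m <= 0)%R then t ^ (- m) - t ^ m else 0) +
  (-1 < x)%R%:R * t ^ m - (1 < x)%R%:R * t ^ (- m).

Section PoissonKernel.
Variables (F : fieldType) (t : F).
Local Notation p := (pkernel t).

Lemma pkernel_mid x m : -1 < x -> x < 1 -> p x m = t ^+ `|m|%N.
Proof.
move=> x1 x2; rewrite /pkernel x1 ltNge (ltW x2) mul1r mul0r subr0.
case: ifP => m0; first by rewrite subrK exprnP; congr (_ ^ _); lia.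
by rewrite add0r exprnP; congr (_ ^ _); lia.
Qed.

Lemma pkernel_gt x m : 1 < x -> p x m = if (0 <= m)%R then t ^ m - t ^ (- m) else 0.
Proof.
move=> x1; have x2 : -1 < x by lra.
rewrite /pkernel x1 x2 !mul1r; case: ifP => m1; case: ifP => m2.
- have -> : m = 0 by lia.
  by rewrite oppr0 subrr addrK.
- ring.
- by rewrite add0r.
- by lia.
Qed.

Lemma pkernel_lt x m : x < -1 -> p x m = if (m <= 0)%R then t ^ (- m) - t ^ m else 0.
Proof.
move=> x1; have x2 : x < 1 by lra.
by rewrite /pkernel !ltNge (ltW x1) (ltW x2) !mul0r addr0 subr0.
Qed.

(** Beyond the poles the expansion is one-sided, and its coefficient at [m = 0] is [t ^ 0 - t ^ 0];
    hence the strict sign. *)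
Lemma pkernel_end_neq0 (c x : rat) m :
  (0 < c -> 1 < x) -> (c < 0 -> x < -1) -> c != 0 -> p x m != 0 ->
  0 < c * m%:~R.
Proof.
move=> cp cn; case: (ltgtP c 0) => // c0 _.
  rewrite pkernel_lt ?cn //; case: ifP => [m0|]; last by rewrite eqxx.
  have [->|mN0] := eqVneq m 0; first by rewrite oppr0 subrr eqxx.
  by rewrite nmulr_rgt0 // ltrz0; lia.
rewrite pkernel_gt ?cp //; case: ifP => [m0|]; last by rewrite eqxx.
have [->|mN0] := eqVneq m 0; first by rewrite oppr0 subrr eqxx.
by rewrite pmulr_rgt0 // ltr0z; lia.
Qed.

(** If no factor vanished, all terms of the relation would be nonnegative, and the one with
    [c k0 != 0] positive. *)
Lemma pkernel_end_prod (I : finType) (P : pred I) (c x : I -> rat) (g : I -> int) :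
  (forall k, P k -> (0 < c k -> 1 < x k) /\ (c k < 0 -> x k < -1)) ->
  \sum_(k | P k) c k * (g k)%:~R = 0 -> (exists2 k, P k & c k != 0) ->
  \prod_(k | P k) p (x k) (g k) = 0.
Proof.
move=> H S [k0 Pk0 ck0]; apply/eqP; apply: contraT => /prodf_neq0 N0.
have pos k : P k -> c k != 0 -> 0 < c k * (g k)%:~R.
  by move=> Pk ck; have [] := H k Pk => h1 h2; apply: pkernel_end_neq0 h1 h2 ck (N0 k Pk).
suff : 0 < \sum_(k | P k) c k * (g k)%:~R by rewrite S ltxx.
rewrite (bigD1 k0) //=; apply: ltr_pwDl; first exact: pos.
apply: sumr_ge0 => k /andP[Pk _].
by have [->|/(pos k Pk)/ltW//] := eqVneq (c k) 0; rewrite mul0r.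
Qed.

(* The parameter at which u + s c takes the value 1 (e = true) or -1. *)
Definition ctime (u c : rat) (e : bool) : rat := ((-1) ^+ (~~ e) - u) / c.

(** Going up through 1 the kernel loses [t ^ (- m)], going up through -1 it gains [t ^ m]. The sign
    of [c] is the direction; [c = 0] yields no jump. *)
Definition cjump (c : rat) (m : int) (e : bool) : F :=
  (sgz c)%:~R * (if e then - t ^ (- m) else t ^ m).

(** The kernel at parameter minus infinity: above both poles for [c < 0], below both for [c > 0],
    constant for [c = 0]. *)
Definition cbase (u c : rat) (m : int) : F :=
  (if (m <= 0)%R then t ^ (- m) - t ^ m else 0) +
  ((c < 0) || (c == 0) && (-1 < u))%R%:R * t ^ m -
  ((c < 0) || (c == 0) && (1 < u))%R%:R * t ^ (- m).

(** At a pole itself the strict comparisons of positions and of times disagree when the path runs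
    downwards, whence the two exclusions. *)
Lemma pkernel_path u c m s :
  u + s * c != 1 -> u + s * c != -1 ->
  p (u + s * c) m =
  cbase u c m + \sum_e (ctime u c e < s)%R%:R * cjump c m e.
Proof.
move=> n1 n2; rewrite big_bool /cbase /cjump /ctime /pkernel /= expr0 expr1.
case: (ltgtP c 0) => c0.
- have E e : u + s * c != e -> ((e - u) / c < s) = ~~ (e < u + s * c).
    move=> ne; rewrite ltr_ndivrMr // -leNgt le_eqVlt (negPf ne) /=.
    by rewrite ltrBrDl.
  rewrite !E // ltr0_sgz //; case: (1 < _); case: (-1 < _); rewrite /= ?mulr1n ?mulr0n; ring.
- have E e : ((e - u) / c < s) = (e < u + s * c).
    by rewrite ltr_pdivrMr // ltrBlDl.
  by rewrite !E gtr0_sgz //= !mul0r subr0 addr0 !mul1r; ring.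
- by rewrite c0 mulr0 addr0 sgz0 !mul0r !mulr0 !addr0.
Qed.

(* Follow the path s |-> u + s c from s = 0 to infinity, where the product of
   kernels vanishes, and collect the jumps met on the way. *)
Lemma pkernel_path_prod (I : finType) (P : pred I) (u c : I -> rat) (g : I -> int) :
  (forall k, P k -> u k != 1 /\ u k != -1) ->
  (forall k l e, P k -> P l -> k != l -> c k != 0 ->
    u l + ctime (u k) (c k) e * c l != 1 /\
    u l + ctime (u k) (c k) e * c l != -1) ->
  \sum_(k | P k) c k * (g k)%:~R = 0 -> (exists2 k, P k & c k != 0) ->
  \prod_(k | P k) p (u k) (g k) = - \sum_(k | P k) \sum_e
    (0 <= ctime (u k) (c k) e)%R%:R * (cjump (c k) (g k) e *
      \prod_(l | P l && (l != k)) p (u l + ctime (u k) (c k) e * c l) (g l)).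
Proof.
move=> u1 gen S E; set r := [seq k <- index_enum I | P k].
pose T k e := ctime (u k) (c k) e; pose J k e := cjump (c k) (g k) e.
pose v k := cbase (u k) (c k) (g k).
have rP k : (k \in r) = P k by rewrite mem_filter mem_index_enum andbT.
have J0 k e : c k = 0 -> J k e = 0 by rewrite /J /cjump => ->; rewrite sgz0 mul0r.
have TT k l e e' : k \in r -> l \in r -> k != l -> T k e = T l e' ->
    J k e * J l e' = 0.
  rewrite !rP => Pk Pl kl Tkl; have [/J0->|ck] := eqVneq (c k) 0; first by rewrite mul0r.
  have [/J0->|cl] := eqVneq (c l) 0; first by rewrite mulr0.
  have [] := gen k l e Pk Pl kl ck; rewrite -/(T k e) Tkl /T /ctime divfK //.
  by rewrite addrC subrK; case: e' {Tkl}; rewrite /= ?expr0 ?expr1 ?eqxx.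
have := fun s => step_prod v s (filter_uniq P (index_enum_uniq I)) TT.
rewrite -/r /= => sp.
(* The factor [J k e] makes the claim trivial for [c k = 0], where [ctime] divides by zero. *)
have pE k l e : P k -> P l -> l != k ->
    J k e * (v l + \sum_e0 (T l e0 < T k e)%R%:R * J l e0) =
    J k e * p (u l + T k e * c l) (g l).
  move=> Pk Pl lk; have [/J0->|ck] := eqVneq (c k) 0; first by rewrite !mul0r.
  have [] := gen k l e Pk Pl _ ck; first by rewrite eq_sym.
  by move=> n1 n2; rewrite pkernel_path.
have JE k e : P k -> J k e * \prod_(l <- r | l != k)
      (v l + \sum_e0 (T l e0 < T k e)%R%:R * J l e0) =
    J k e * \prod_(l | P l && (l != k)) p (u l + T k e * c l) (g l).
  move=> Pk; rewrite big_filter_cond.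
  have [->|J0'] := eqVneq (J k e) 0; first by rewrite !mul0r.
  congr (_ * _); apply: eq_bigr => l /andP[Pl lk].
  by apply: (mulfI J0'); apply: pE.
have spE s : \prod_(k | P k) (v k + \sum_e (T k e < s)%R%:R * J k e) =
    \prod_(k <- r) v k + \sum_(k | P k) \sum_e (T k e < s)%R%:R *
     (J k e * \prod_(l | P l && (l != k)) p (u l + T k e * c l) (g l)).
  rewrite -big_filter -/r sp; congr (_ + _); rewrite big_filter.
  by apply: eq_bigr => k Pk; apply: eq_bigr => e _; rewrite JE.
(* A time past all crossings, where [pkernel_end_prod] applies. *)
pose b := 1 + \sum_k \sum_e `|T k e|.
have Tb k e : T k e < b.
  rewrite /b (bigD1 k) //= (bigD1 e) //=.
  have h1 : 0 <= \sum_(i | i != e) `|T k i| by apply: sumr_ge0.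
  have h2 : 0 <= \sum_(i | i != k) \sum_e `|T i e|.
    by apply: sumr_ge0 => i _; apply: sumr_ge0.
  have := ler_norm (T k e); lra.
have xb k : P k -> (0 < c k -> 1 < u k + b * c k) /\ (c k < 0 -> u k + b * c k < -1).
  move=> Pk; split=> ck.
    by have := Tb k true; rewrite /T /ctime ltr_pdivrMr //= expr0 ltrBlDl.
  by have := Tb k false; rewrite /T /ctime ltr_ndivrMr //= expr1 ltrBrDl.
have xbN k : P k -> u k + b * c k != 1 /\ u k + b * c k != -1.
  move=> Pk; have [h1 h2] := xb k Pk; case: (ltgtP (c k) 0) => [ck|ck|->].
  - by have := h2 ck; split; lra.
  - by have := h1 ck; split; lra.
  - by rewrite mulr0 addr0; apply: u1.
have Eb : \prod_(k | P k) (v k + \sum_e (T k e < b)%R%:R * J k e) = 0.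
  rewrite -[RHS](pkernel_end_prod xb S E); apply: eq_bigr => k Pk.
  by have [n1 n2] := xbN k Pk; rewrite pkernel_path.
have E0 : \prod_(k | P k) (v k + \sum_e (T k e < 0)%R%:R * J k e) =
    \prod_(k | P k) p (u k) (g k).
  apply: eq_bigr => k Pk; have [n1 n2] := u1 k Pk.
  by rewrite -pkernel_path ?mul0r ?addr0.
rewrite -E0 spE; apply/eqP; rewrite -addr_eq0 -addrA -big_split /=.
rewrite -[X in _ == X]Eb spE; apply/eqP; congr (_ + _); apply: eq_bigr => k Pk.
rewrite -big_split /=; apply: eq_bigr => e _; rewrite -mulrDl Tb mul1r.
by case: ltP; rewrite ?addr0 ?add0r mul1r.
Qed.

End PoissonKernel.

(** * Minors of the weight matrix and positions of crossing points *)

Section Minors.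
Variables (n : nat) (A : 'M[int]_(2, n)).
Local Notation d := (minor A).

Lemma minorC i j : d i j = - d j i.
Proof. by rewrite /minor; ring. Qed.

(** Expansion along the top row of a 3 x 3 determinant on the columns i, j, k: row l of A placed
    above the two rows of A, so that a row is repeated. *)
Lemma minor_plucker i j k l : A l i * d j k - A l j * d i k + A l k * d i j = 0.
Proof.
have [->|->] : l = 0 \/ l = 1 by case: l => [[|[|]]] //= lp; [left|right]; apply: val_inj.
- by rewrite /minor; ring.
- by rewrite /minor; ring.
Qed.

(** If all minors involving j vanished, the relation above would give [A 0 j * d k l = 0], so every
    minor and their gcd would be 0. *)
Lemma exists_minor_neq0 j : faithful A -> standard_form A -> exists k, d j k != 0.
Proof.
move=> [_ g1] st; apply: contrapT => /forallNP N.
have d0 k : d j k = 0 by apply/eqP/negPn/negP/N.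
move: g1; rewrite (_ : \big[gcdz/0]_(i < n) _ = 0) //.
apply: (big_ind (fun x => x = 0)) => // [x y -> ->//|k _].
apply: (big_ind (fun x => x = 0)) => // [x y -> ->//|l _].
have := minor_plucker j k l 0; rewrite !d0 !mulr0 subr0 addr0 => /eqP.
by rewrite mulf_eq0 gt_eqF ?st // => /eqP.
Qed.

Lemma minor_ker (g : 'I_n -> int) j :
  (forall i, \sum_k A i k * g k = 0) -> \sum_k d j k * g k = 0.
Proof.
move=> gk; rewrite /minor; under eq_bigr do rewrite mulrBl -!mulrA.
by rewrite sumrB -!mulr_sumr !gk !mulr0 subrr.
Qed.

End Minors.

Lemma antisym_sum (F : numFieldType) (I : finType) (S : I -> I -> F) :
  (forall i j, i != j -> S i j = - S j i) -> \sum_i \sum_(j | j != i) S i j = 0.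
Proof.
move=> SN; set s := LHS.
have sE : s = - s.
  rewrite {1}/s (exchange_big_dep predT) //= -sumrN; apply: eq_bigr => i _.
  rewrite -sumrN; apply: eq_big => [j|j ij]; first by rewrite eq_sym.
  by rewrite SN // eq_sym.
have : s *+ 2 == 0 by rewrite mulr2n {1}sE addNr.
by rewrite mulrn_eq0 => /eqP.
Qed.

(** Cramer's rule on the line <y, a_j> = 1, run through from its point with second coordinate 0 so
    that <y, a_l> has speed [jl]. The right-hand side is <y, a_l> at the point where <y, a_k> is 1
    or -1; [aj], [ak], [al] are first-row entries and [jk], [kl], [jl] minors. *)
Lemma crossing_position (aj ak al jk kl jl : int) (e : bool) :
  aj != 0 -> jk != 0 -> aj * kl - ak * jl + al * jk = 0 ->
  al%:~R / aj%:~R + ctime (ak%:~R / aj%:~R) jk%:~R e * jl%:~R =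
  if e then (jl - kl)%:~R / jk%:~R else (kl + jl)%:~R / (- jk)%:~R.
Proof.
rewrite -!(intr_eq0 rat) => aj0 jk0 /(congr1 (intr : int -> rat)).
rewrite /ctime !(intrD, rmorphN, intrM) /= => E.
have -> : al%:~R = (ak%:~R * jl%:~R - aj%:~R * kl%:~R) / jk%:~R :> rat.
  by apply: (mulIf jk0); rewrite divfK //; lra.
by case: e; rewrite /= ?expr0 ?expr1; field; rewrite ?oppr_eq0 ?jk0 ?aj0.
Qed.

(** * The identity of Laurent polynomials for one kernel vector *)

Section Pointwise.
Variables (F : numFieldType) (t : F) (n : nat) (A : 'M[int]_(2, n)).
Hypotheses (t0 : t != 0) (fA : faithful A) (gA : completely_generic A).
Local Notation d := (minor A).
Local Notation p := (pkernel t).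
Local Notation "x %:q" := (x%:~R : rat) (at level 2, format "x %:q").

(** Along y = (s, 0) factor k sits at [s * A 0 k]. By standard form only poles at 1 are met for s >
    0, and distinct first-row entries are met at distinct times. *)
Lemma pkernel_origin (g : 'I_n -> int) : (forall i, \sum_k A i k * g k = 0) ->
  (0 < n)%N ->
  \prod_k p 0 (g k) =
  \sum_j t ^ (- g j) * \prod_(l | l != j) p ((A 0 l)%:q / (A 0 j)%:q) (g l).
Proof.
move=> gk n0; have [[st inj _] _] := gA.
have a0 k : 0 < (A 0 k)%:q by rewrite ltr0z st.
rewrite (@pkernel_path_prod _ t _ predT (fun _ => 0) (fun k => (A 0 k)%:q)); first last.
- by exists (Ordinal n0) => //; rewrite gt_eqF.
- rewrite -[RHS](_ : (0 : int)%:q = 0) // -(gk 0) rmorph_sum /=.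
  by apply: eq_bigr => k _; rewrite rmorphM.
- move=> k l e _ _ kl _; rewrite !add0r /ctime subr0.
  have al := inj _ _ kl; have := a0 l; have := a0 k; move: al.
  rewrite -(inj_eq (@intr_inj rat)); move: (A 0 k)%:q (A 0 l)%:q => x y xy x0 y0.
  have xN0 : x != 0 by rewrite gt_eqF.
  have yx : y / x != 1.
    by apply: contra xy => /eqP yx; rewrite -[y](divfK xN0) yx mul1r.
  have yx0 : 0 < y / x by rewrite divr_gt0.
  by rewrite mulrAC -mulrA; case: e; rewrite /= ?expr0 ?expr1; split; lra.
- by [].
rewrite -sumrN; apply: eq_bigr => j _; rewrite big_bool /= /ctime !subr0 !expr0 !expr1.
rewrite divr_ge0 ?ler01 ?(ltW (a0 j)) // !mul1r.
rewrite leNgt (_ : -1 / _ < 0) ?mul0r ?addr0; last by rewrite ltr_pdivrMr ?mul0r.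
rewrite /cjump gtr0_sgz // mulr1z mul1r mulNr opprK; congr (_ * _).
by apply: eq_bigr => l _; rewrite add0r mulrC.
Qed.

(** Along <y, a_j> = 1, from the point (1 / [A 0 j], 0), factor l moves with speed [d j l]. All
    factors start at positive positions, so factor k reaches -1 exactly if [d j k < 0], while 1 lies
    ahead exactly if [A 0 j - A 0 k] and [d j k] have the same sign. *)
Lemma pkernel_line (g : 'I_n -> int) j : (forall i, \sum_k A i k * g k = 0) ->
  \prod_(l | l != j) p ((A 0 l)%:q / (A 0 j)%:q) (g l) =
  \sum_(k | k != j)
    ((d k j > 0)%R%:R * (t ^ g k *
       \prod_(l | (l != k) && (l != j)) p ((d k l + d j l)%:q / (d k j)%:q) (g l)) +
     ((A 0 j - A 0 k) * d j k > 0)%R%:R * ((sgz (d j k))%:~R * t ^ (- g k) *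
       \prod_(l | (l != k) && (l != j)) p ((d j l - d k l)%:q / (d j k)%:q) (g l))).
Proof.
move=> gk; have [[st inj gen1] gen2] := gA.
have a0 k : 0 < (A 0 k)%:q by rewrite ltr0z st.
have aN0 k : (A 0 k)%:q != 0 by rewrite gt_eqF.
pose u l := (A 0 l)%:q / (A 0 j)%:q; pose c l := (d j l)%:q.
have u0 l : 0 < u l by rewrite divr_gt0.
have u1 l : l != j -> u l != 1.
  move=> lj; apply: contraNneq (inj _ _ lj) => ul.
  by rewrite -(inj_eq (@intr_inj rat)) -[(A 0 l)%:q](divfK (aN0 j)) -/(u l) ul mul1r.
have xE k l (e : bool) : d j k != 0 -> u l + ctime (u k) (c k) e * c l =
    if e then (d j l - d k l)%:q / (d j k)%:q else (d k l + d j l)%:q / (d k j)%:q.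
  move=> dk; rewrite (minorC A k j); apply: crossing_position => //.
    by rewrite gt_eqF.
  exact: minor_plucker.
have qN0 (x y z : int) : y != 0 -> x - y * z != 0 -> x%:q / y%:q != z%:q.
  move=> y0; apply: contraNneq => E; rewrite -(intr_eq0 rat) rmorphB rmorphM /=.
  by rewrite mulrC -E divfK ?intr_eq0 // subrr.
rewrite (@pkernel_path_prod _ t _ (fun l => l != j) u c); first last.
- by have [k dk] := exists_minor_neq0 j fA st; exists k; rewrite ?intr_eq0 //;
    apply: contraNneq dk => ->; rewrite /minor mulrC subrr.
- rewrite -[RHS](_ : (0 : int)%:q = 0) // -(minor_ker j gk) rmorph_sum /=.
  rewrite [RHS](bigD1 j) //= [d j j](_ : _ = 0) ?mul0r ?add0r; last by rewrite /minor; ring.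
  by apply: eq_bigr => k _; rewrite rmorphM.
- move=> k l e kj lj kl; rewrite intr_eq0 => dk; rewrite xE //.
  have dk' : d k j != 0 by rewrite minorC oppr_eq0.
  have jk : j != k by rewrite eq_sym.
  have jl : j != l by rewrite eq_sym.
  have lk : l != k by rewrite eq_sym.
  (* The four ways a third factor could sit on a pole at the crossing. Genericity rules out three of
     them; [g4] rules out a common point of <y, a_j> = 1, <y, a_k> = 1 and <y, a_l> = 1, and this is
     where complete genericity enters. *)
  have g1 := gen1 j l k jl jk lk.
  have g2 := gen1 j k l jk jl kl.
  have g3 := gen1 k j l kj kl jl.
  have g4 := gen2 j k l jk jl kl.
  have c1 := minorC A j k; have c2 := minorC A j l; have c3 := minorC A k l.
  rewrite -[1]/(1%:q) -[-1]/((-1)%:q).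
  case: e; split; apply: qN0 => //; lia.
- by move=> k kj; split; [exact: u1 | rewrite gt_eqF // (lt_trans _ (u0 k))].
rewrite -sumrN; apply: eq_bigr => k kj; rewrite big_bool /= opprD addrC.
have jump0 e : d j k = 0 -> cjump t (c k) (g k) e = 0.
  by rewrite /cjump /c => ->; rewrite sgz0 mul0r.
have [dk|dk] := eqVneq (d j k) 0.
  rewrite !jump0 // dk minorC dk oppr0 ltxx mulr0 ltxx.
  by rewrite !mul0r !mulr0 !oppr0.
have prodE e : \prod_(l | (l != j) && (l != k)) p (u l + ctime (u k) (c k) e * c l) (g l) =
   \prod_(l | (l != k) && (l != j)) p (if e then (d j l - d k l)%:q / (d j k)%:q
       else (d k l + d j l)%:q / (d k j)%:q) (g l).
  by apply: eq_big => [l|l _]; [rewrite andbC | rewrite xE].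
rewrite !prodE /cjump; congr (_ + _).
- have -> : (0 <= ctime (u k) (c k) false) = (0 < d k j).
    rewrite minorC oppr_gt0 /ctime /= expr1 /c; case: (ltgtP (d j k) 0) dk => // dk _.
      by rewrite ler_ndivlMr ?ltrz0 // mul0r subr_le0 (le_trans _ (ltW (u0 k))).
    by rewrite ler_pdivlMr ?ltr0z // mul0r subr_ge0 leNgt (lt_trans _ (u0 k)).
  rewrite minorC oppr_gt0 /c; case: ltP => // dk'; last by rewrite !mul0r oppr0.
  by rewrite ltr0_sgz ?ltrz0 //= mulrN1z mulN1r mulNr mulrN opprK.
have -> : (0 <= ctime (u k) (c k) true) = (0 < (A 0 j - A 0 k) * d j k).
  have ukE : 1 - u k = (A 0 j - A 0 k)%:q / (A 0 j)%:q.
    by rewrite rmorphB /= mulrBl divff.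
  have ajk : A 0 j - A 0 k != 0 by rewrite subr_eq0 inj // eq_sym.
  rewrite /ctime /= expr0 ukE /c; move: (A 0 j - A 0 k) ajk => x x0.
  case: (ltgtP (d j k) 0) dk => // dk _.
    rewrite ler_ndivlMr ?ltrz0 // mul0r ler_pdivrMr // mul0r lerz0 nmulr_lgt0 //.
    by rewrite le_eqVlt (negPf x0).
  rewrite ler_pdivlMr ?ltr0z // mul0r ler_pdivlMr // mul0r ler0z pmulr_lgt0 //.
  by rewrite le_eqVlt eq_sym (negPf x0).
have -> : sgz (c k) = sgz (d j k).
  rewrite /c; case: (ltgtP (d j k) 0) dk => // dk' _.
    by rewrite ltr0_sgz ?ltrz0 // ltr0_sgz.
  by rewrite !gtr0_sgz ?ltr0z.
rewrite -mulrN -!mulNr; congr (_ * (_ * _)).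
by rewrite mulrNN.
Qed.

(* The crossings of two lines <y, a_j> = <y, a_k> = 1 are met twice, in opposite
   directions, so that only those of <y, a_i> = -1 and <y, a_j> = 1 remain. *)
Lemma pkernel_expansion (g : 'I_n -> int) : (forall i, \sum_k A i k * g k = 0) ->
  (0 < n)%N ->
  t ^+ (\sum_k `|g k|%N) =
  \sum_i \sum_(j | (i != j) && (0 < d i j)) t ^ (g i - g j) *
    \prod_(l | (l != i) && (l != j)) p ((d i l + d j l)%:q / (d i j)%:q) (g l).
Proof.
move=> gk n0; rewrite expr_sum.
rewrite -[LHS](_ : \prod_k p 0 (g k) = _); last first.
  by apply: eq_bigr => k _; rewrite pkernel_mid.
rewrite pkernel_origin //; under eq_bigr do rewrite pkernel_line // big_split mulrDr.
have [[st inj _] _] := gA.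
rewrite big_split /= [X in _ + X](_ : _ = 0) ?addr0.
  under eq_bigr do rewrite mulr_sumr.
  rewrite (exchange_big_dep predT) //=; apply: eq_bigr => i _.
  rewrite big_mkcondr /=; apply: eq_big => [j|j _]; first by rewrite eq_sym.
  case: ifP => _; last by rewrite mul0r mulr0.
  by rewrite mul1r mulrA -expfzDr // addrC.
under eq_bigr do rewrite mulr_sumr.
(* At <y, a_i> = <y, a_j> = 1 the power of t, the indicator and the product of kernels are symmetric
   in i and j; only the sign of the minor changes. *)
apply: antisym_sum => i j ij.
have -> : (A 0 i - A 0 j) * d i j = (A 0 j - A 0 i) * d j i by rewrite /minor; ring.
rewrite (minorC A i j) sgzN.
rewrite mulrNz !mulNr !mulrN; congr (- _); rewrite !mulrA.
rewrite [X in _ * X](_ : _ = \prod_(l | (l != i) && (l != j))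
    p ((d j l - d i l)%:q / (d j i)%:q) (g l)); first by ring.
apply: eq_big => [l|l _]; first by rewrite andbC.
by congr (p _ _); rewrite -opprB !rmorphN /= invrN mulrNN.
Qed.

End Pointwise.

(** * Dimensions of quotients *)

Section QuotBasis.
Variable K : fieldType.

Lemma quot_basisI (V : lmodType K) (U W : set V) k (b : 'I_k -> V) :
  subspace W -> (forall i, U (b i)) ->
  (forall u, U u -> exists c : 'rV[K]_k, W (u - \sum_i c 0 i *: b i)) ->
  (forall c : 'rV[K]_k, W (\sum_i c 0 i *: b i) -> c = 0) -> quot_basis U W b.
Proof.
move=> sW Ub span free; split=> // u /span[c Wc]; exists c; split=> // c' Wc'.
apply/eqP; rewrite -subr_eq0; apply/eqP/free.
have := subspaceB sW Wc' Wc; congr (W _).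
rewrite opprB addrC addrA subrK -sumrB.
by apply: eq_bigr => i _; rewrite !mxE scalerBl.
Qed.

Definition add_image (V V' : lmodType K) (W : set V) (f : V' -> V) (U' : set V') : set V :=
  [set v | exists w u, [/\ W w, U' u & v = w + f u]].

Lemma subspaceD (V : lmodType K) (U : set V) u v : subspace U -> U u -> U v -> U (u + v).
Proof. by move=> [_ UD] Uu Uv; rewrite -[u]scale1r; apply: UD. Qed.

Lemma add_image_subspace (V V' : lmodType K) (W : set V) (f : {linear V' -> V}) U' :
  subspace W -> subspace U' -> subspace (add_image W f U').
Proof.
move=> [W0 WD] [U0 UD]; split; first by exists 0, 0; rewrite linear0 addr0.
move=> a u v [w [x [Ww Ux ->]]] [w' [x' [Ww' Ux' ->]]].
exists (a *: w + w'), (a *: x + x'); split; [exact: WD | exact: UD |].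
by rewrite linearP scalerDr addrACA.
Qed.

(* Exactness of U'/W' -> U/W -> U/(W + f U') -> 0 with f injective on U'/W'. *)
Lemma quot_basis_exact (V V' : lmodType K) (U W : set V) (U' W' : set V')
    (f : {linear V' -> V}) k k' m
    (b : 'I_k -> V) (b' : 'I_k' -> V') (c : 'I_m -> V) :
  subspace U -> subspace W -> subspace U' -> subspace W' ->
  (forall u, U' u -> U (f u)) -> (forall u, U' u -> W (f u) <-> W' u) ->
  quot_basis U W b -> quot_basis U' W' b' ->
  quot_basis U (add_image W f U') c -> k = (k' + m)%N.
Proof.
move=> sU sW sU' sW' fU fW Bb Bb' Bc.
have sI := add_image_subspace f sW sU'.
pose e (i : 'I_(k' + m)) := match fintype.split i with inl j => f (b' j) | inr j => c j end.
have eE (x : 'rV[K]_(k' + m)) : \sum_i x 0 i *: e i =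
    f (\sum_i x 0 (lshift m i) *: b' i) + \sum_i x 0 (rshift k' i) *: c i.
  rewrite big_split_ord /= linear_sum; congr (_ + _); apply: eq_bigr => i _.
    rewrite /e -[lshift m i]/(unsplit (inl i)) unsplitK; exact/esym/linearZ.
  by rewrite /e -[rshift k' i]/(unsplit (inr i)) unsplitK.
suff Be : quot_basis U W e.
  by apply/eqP; rewrite eqn_leq (quot_basis_leq sU sW Bb Be) (quot_basis_leq sU sW Be Bb).
apply: quot_basisI => //.
- by move=> i; rewrite /e; case: (fintype.split i) => j; [apply/fU/Bb'.1 | apply: Bc.1].
- move=> u Uu; have [x [[w [v [Ww U'v uE]]] _]] := Bc.2 _ Uu.
  have [y [W'y _]] := Bb'.2 _ U'v.
  exists (row_mx y x); rewrite eE.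
  under eq_bigr do rewrite row_mxEl.
  under [X in _ - (_ + X)]eq_bigr do rewrite row_mxEr.
  have U'y : U' (v - \sum_i y 0 i *: b' i).
    by apply: subspaceB => //; apply: (subspace_sum (fun i => y 0 i)) => //; exact: Bb'.1.
  have := subspaceD sW Ww ((fW _ U'y).2 W'y); congr (W _).
  by rewrite linearB addrA -uE opprD addrA addrAC.
- move=> x; rewrite eE => Wx.
  have xr : \row_i x 0 (rshift k' i) = 0.
    apply: (quot_basis_free sU sI Bc).
    exists (f (\sum_i x 0 (lshift m i) *: b' i) + \sum_i x 0 (rshift k' i) *: c i).
    exists (- \sum_i x 0 (lshift m i) *: b' i); split=> //.
      rewrite -scaleN1r -[_ *: _]addr0; apply: sU'.2; last exact: sU'.1.
      by apply: (subspace_sum (fun i => x 0 (lshift m i))) => //; exact: Bb'.1.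
    by rewrite linearN addrAC subrr add0r; apply: eq_bigr => i _; rewrite mxE.
  have xr0 i : x 0 (rshift k' i) = 0 by move/rowP/(_ i): xr; rewrite !mxE.
  have xl : \row_i x 0 (lshift m i) = 0.
    apply: (quot_basis_free sU' sW' Bb').
    under eq_bigr do rewrite mxE.
    apply/fW; first by apply: (subspace_sum (fun i => x 0 (lshift m i))) => //; exact: Bb'.1.
    by move: Wx; rewrite [X in _ + X]big1 ?addr0 // => i _; rewrite xr0 scale0r.
  apply/rowP => i; rewrite mxE; case: (split_ordP i) => j ->.
    by move/rowP/(_ j): xl; rewrite !mxE.
  exact: xr0.
Qed.

Lemma quot_basis_eqW (V : lmodType K) (U W W' : set V) k (b : 'I_k -> V) :
  subspace U -> (forall u, U u -> W u <-> W' u) -> quot_basis U W b -> quot_basis U W' b.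
Proof.
move=> sU WW' [Ub B]; split=> // u Uu; have [c [Wc uc]] := B u Uu.
have Uc (x : 'rV[K]_k) : U (u - \sum_i x 0 i *: b i).
  by apply: subspaceB => //; apply: (subspace_sum (fun i => x 0 i)).
by exists c; split=> [|c' W'c']; [apply/WW' | apply/uc/WW'].
Qed.

End QuotBasis.

Lemma subspace_set0 (K : fieldType) (V : lmodType K) : subspace [set 0 : V].
Proof. by split=> // a u v -> ->; rewrite /= scaler0 addr0. Qed.

Section Supported.
Variables (K : fieldType) (N : nat).
Implicit Types (E : pred 'X_{1..N}) (p : {mpoly K[N]}).

Definition supported E : set {mpoly K[N]} := [set p | forall m, ~~ E m -> p@_m = 0].

Lemma supported_subspace E : subspace (supported E).
Proof.
split=> [m _|a u v uE vE m Em]; first by rewrite mcoeff0.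
by rewrite mcoeffD mcoeffZ uE ?vE // mulr0 addr0.
Qed.

Definition restrict E p : {mpoly K[N]} := \sum_(m <- msupp p | E m) p@_m *: 'X_[m].

Lemma mcoeff_restrict E p m : (restrict E p)@_m = if E m then p@_m else 0.
Proof.
rewrite /restrict raddf_sum /= big_mkcond /=.
under eq_bigr do rewrite mcoeffZ mcoeffX.
have [mp|mp] := boolP (m \in msupp p).
  rewrite (bigD1_seq m) ?msupp_uniq //= eqxx mulr1 big1 ?addr0 // => m' /negPf ->.
  by rewrite mulr0 if_same.
rewrite (memN_msupp_eq0 mp) if_same big1_seq // => m' /= m'p.
rewrite (_ : (m' == m) = false) ?mulr0 ?if_same //.
by apply: contraNF mp => /eqP <-.
Qed.

Lemma restrict_supported E p : supported E (restrict E p).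
Proof. by move=> m /negPf Em; rewrite mcoeff_restrict Em. Qed.

Lemma restrict_id E p : supported E p -> restrict E p = p.
Proof.
by move=> pE; apply/mpolyP => m; rewrite mcoeff_restrict; case: ifPn => // /pE ->.
Qed.

Lemma mcoeff_mulX p k m :
  (p * 'X_[k])@_m = if (k <= m)%MM then p@_(m - k)%MM else 0.
Proof.
case: ifPn => km; first by have := mcoeffMX p k (m - k)%MM; rewrite addmC submK.
apply: memN_msupp_eq0; rewrite (perm_mem (msuppMX _ _)).
by apply: contra km => /mapP[x _ ->]; rewrite lem_addr.
Qed.

Lemma supported_basis E (s : seq 'X_{1..N}) : uniq s -> (forall m, E m = (m \in s)) ->
  quot_basis (supported E) [set 0] (fun i : 'I_(size s) => 'X_[K, tnth (in_tuple s) i]).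
Proof.
move=> us Es; apply: quot_basisI; first exact: subspace_set0.
- move=> i m; rewrite Es mcoeffX; case: eqP => // <-.
  by rewrite mem_tnth.
- move=> p pE; exists (\row_i p@_(tnth (in_tuple s) i)); apply/eqP; rewrite subr_eq0.
  apply/eqP/mpolyP => m; rewrite raddf_sum /=.
  under eq_bigr do rewrite mxE mcoeffZ mcoeffX.
  rewrite -(big_tuple _ _ (in_tuple s) xpredT (fun x => p@_x * (x == m)%:R)) /=.
  have [ms|ms] := boolP (m \in s).
    rewrite (bigD1_seq m) //= eqxx mulr1 big1 ?addr0 // => m' /negPf ->.
    by rewrite mulr0.
  rewrite pE ?Es // big1_seq // => m' /= m's.
  rewrite (_ : (m' == m) = false) ?mulr0 //; by apply: contraNF ms => /eqP <-.
- move=> c /= c0; apply/rowP => i; rewrite mxE.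
  have : (\sum_(i < size s) c 0 i *: 'X_[K, tnth (in_tuple s) i])@_(tnth (in_tuple s) i) = 0.
    by rewrite c0 mcoeff0.
  rewrite raddf_sum /= (bigD1 i) //= mcoeffZ mcoeffX eqxx mulr1 big1 ?addr0 // => j ji.
  rewrite mcoeffZ mcoeffX -val_eqE /= !(tnth_nth 0%MM) /=.
  rewrite (_ : _ == _ = false) ?mulr0 //.
  by apply: contraNF ji => /eqP/val_inj/eqP; rewrite nth_uniq // => /eqP/val_inj ->.
Qed.

End Supported.

(** * Regularity of the two moment quadrics *)

Section QuadricRegularity.
Variables (K : fieldType) (n : nat).
Local Notation P := {mpoly K[n + n]}.

(* The monomial z_j w_j, the variables z_j, w_j being lshift n j, rshift n j. *)
Definition pair_mnm (j : 'I_n) : 'X_{1..n + n} := (U_(lshift n j) + U_(rshift n j))%MM.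

Definition quadric (a : 'I_n -> K) : P := \sum_j a j *: 'X_[pair_mnm j].

Lemma pair_mnm_lshift j k : pair_mnm j (lshift n k) = (j == k).
Proof. by rewrite /pair_mnm mnmDE !mnm1E eq_lshift eq_rlshift addn0. Qed.

Lemma pair_mnm_rshift j k : pair_mnm j (rshift n k) = (j == k).
Proof. by rewrite /pair_mnm mnmDE !mnm1E eq_rshift eq_lrshift add0n. Qed.

Lemma mdeg_pair_mnm j : mdeg (pair_mnm j) = 2%N.
Proof. by rewrite mdegD !mdeg1. Qed.

Lemma lep_pair_mnm j m :
  (pair_mnm j <= m)%MM = (0 < m (lshift n j))%N && (0 < m (rshift n j))%N.
Proof.
apply/mnm_lepP/andP => [le|[h1 h2] k].
  by have := le (lshift n j); have := le (rshift n j);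
    rewrite pair_mnm_lshift pair_mnm_rshift eqxx.
by case: (split_ordP k) => i ->; rewrite ?pair_mnm_lshift ?pair_mnm_rshift;
  case: eqP => // <-.
Qed.

Lemma mcoeff_mul_quadric p a m :
  (p * quadric a)@_m =
  \sum_j if (pair_mnm j <= m)%MM then a j * p@_(m - pair_mnm j)%MM else 0.
Proof.
rewrite /quadric mulr_sumr raddf_sum /=; apply: eq_bigr => j _.
rewrite -scalerAr mcoeffZ mcoeff_mulX.
by case: ifP; rewrite ?mulr0.
Qed.

(** All monomials of a quadric are of the form [pair_mnm j], so multiplying by it commutes with
    selecting monomials. This does the work of averaging over the torus and of taking homogeneous
    parts. *)
Lemma restrict_mul_quadric (E E' : pred 'X_{1..n + n}) p a :
  (forall m j, E (m + pair_mnm j)%MM = E' m) ->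
  restrict E (p * quadric a) = restrict E' p * quadric a.
Proof.
move=> EE'; apply/mpolyP => m; rewrite mcoeff_restrict !mcoeff_mul_quadric.
rewrite -[LHS]/(if E m then _ else _).
case: ifP => Em; last rewrite [RHS]big1 //; first apply: eq_bigr => j _; last move=> j _.
  by case: ifP => // jm; rewrite mcoeff_restrict -(EE' _ j) submK ?Em.
by case: ifP => // jm; rewrite mcoeff_restrict -(EE' _ j) submK ?Em ?mulr0.
Qed.

Lemma quadric_eq0 a : (quadric a == 0) = [forall j, a j == 0].
Proof.
apply/eqP/forallP => [q0 j|a0]; last by rewrite /quadric big1 // => j _; rewrite (eqP (a0 j)) scale0r.
have := congr1 (mcoeff (pair_mnm j)) q0.
rewrite mcoeff0 /quadric raddf_sum /= (bigD1 j) //= mcoeffZ mcoeffX eqxx mulr1.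
rewrite big1 ?addr0 => [->//|i ij]; rewrite mcoeffZ mcoeffX.
rewrite (_ : _ == _ = false) ?mulr0 //; apply: contraNF ij => /eqP/(congr1 (fun m : 'X_{1..n+n} => m (lshift n j))).
by rewrite !pair_mnm_lshift eqxx; case: eqP.
Qed.

Section Division.
Variables (a : 'I_n -> K) (k : 'I_n).
Hypothesis ak : a k != 0.

(** Normal forms modulo [quadric a], with z_k w_k in the role of leading monomial. *)
Definition reduced : set P := supported (fun m => ~~ (pair_mnm k <= m)%MM).

(** Replacing z_k w_k by the other z_j w_j lowers the exponent of z_k by one, which gives the
    induction. *)
Lemma quadric_division p : exists s, reduced (p - s * quadric a).
Proof.
pose D p := exists s, reduced (p - s * quadric a).
have sub := @supported_subspace K _ (fun m => ~~ (pair_mnm k <= m)%MM).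
have D0 : D 0 by exists 0; rewrite mul0r subr0; exact: sub.1.
have DD c u v : D u -> D v -> D (c *: u + v).
  move=> [s Hs] [s' Hs']; exists (c *: s + s'); have := sub.2 c _ _ Hs Hs'; congr (_ _).
  by rewrite mulrDl -scalerAl scalerBr opprD addrACA.
have Dsum I (r : seq I) (Q : pred I) (x : I -> P) : (forall i, Q i -> D (x i)) ->
    D (\sum_(i <- r | Q i) x i).
  move=> Dx; apply: big_ind => // u v Du Dv; rewrite -[u]scale1r; exact: DD.
have DX e (m : 'X_{1..n + n}) : m (lshift n k) = e -> D 'X_[m].
  elim: e m => [|e IH] m me.
    exists 0; rewrite mul0r subr0 => m'; rewrite negbK mcoeffX => km'.
    case: eqP => // mm'; move: km'; rewrite -mm' lep_pair_mnm me.
    by [].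
  have [km|km] := boolP (pair_mnm k <= m)%MM; last first.
    exists 0; rewrite mul0r subr0 => m'; rewrite negbK mcoeffX => km'.
    by case: eqP => // mm'; move: km; rewrite mm' km'.
  pose m' := (m - pair_mnm k)%MM.
  have -> : 'X_[m] = (a k)^-1 *: ('X_[m'] * quadric a) +
      (- (a k)^-1) *: \sum_(j | j != k) a j *: 'X_[m' + pair_mnm j] :> P.
    rewrite {1}/quadric (bigD1 k) //= mulrDr scalerDr -scalerAr scalerA mulVf // scale1r.
    rewrite -mpolyXD submK // mulr_sumr -addrA scaleNr.
    rewrite [X in _ + (X - _)](_ : _ = (a k)^-1 *: \sum_(j | j != k) a j *: 'X_[m' + pair_mnm j]).
      by rewrite subrr addr0.
    by congr (_ *: _); apply: eq_bigr => j _; rewrite mpolyXD scalerAr.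
  apply: (DD _ _ _); last rewrite -[_ *: _]addr0; last apply: (DD _ _ _) => //.
    by exists 'X_[m']; rewrite subrr; exact: sub.1.
  apply: Dsum => j jk; rewrite -[_ *: _]addr0; apply: (DD _ _ _) => //; apply: IH.
  by rewrite mnmDE mnmBE !pair_mnm_lshift me eqxx (negPf jk) addn0 subn1.
rewrite [p]mpolyE; apply: (Dsum _ _ xpredT) => m _.
by rewrite -[_ *: _]addr0; apply: (DD _ _ _) => //; apply: DX erefl.
Qed.

(** Let m be a monomial of s with the largest exponent of z_k. In the product, m z_k w_k arises from
    m alone: any other source m z_k w_k / (z_j w_j) has a larger exponent of z_k. *)
Lemma reduced_mul_quadric s : reduced (s * quadric a) -> s = 0.
Proof.
move=> red; apply/eqP; apply: contraT => s0.
have [m0 m0s] : exists m, m \in msupp s.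
  by exists (mlead s); apply: mlead_supp.
have [m ms mmax] : exists2 m, m \in msupp s &
    forall m', m' \in msupp s -> (m' (lshift n k) <= m (lshift n k))%N.
  pose Q e := has (fun m : 'X_{1..n+n} => m (lshift n k) == e) (msupp s).
  have Q0 : exists e, Q e by exists (m0 (lshift n k)); apply/hasP; exists m0.
  have Qb e : Q e -> (e <= \max_(m <- msupp s) m (lshift n k))%N.
    by case/hasP => m ms /eqP <-; rewrite (bigD1_seq m) ?msupp_uniq //= leq_maxl.
  have [e /hasP[m ms /eqP me] emax] := ex_maxnP Q0 Qb.
  exists m => // m' m's; rewrite me; apply: emax; apply/hasP; exists m' => //.
have := red (m + pair_mnm k)%MM; rewrite negbK lem_addl => /(_ isT).
rewrite mcoeff_mul_quadric (bigD1 k) //= lem_addl addmK big1 ?addr0.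
  by move/eqP; rewrite mulf_eq0 (negPf ak) /= mcoeff_eq0 ms.
move=> j jk; case: ifP => // _; rewrite memN_msupp_eq0 ?mulr0 //.
apply/negP => /mmax; rewrite mnmBE mnmDE !pair_mnm_lshift eqxx (negPf jk).
by rewrite subn0 addn1 ltnn.
Qed.

Lemma mul_quadric_reduced b p : b k = 0 -> reduced p -> reduced (p * quadric b).
Proof.
move=> bk rp m; rewrite negbK => km; rewrite mcoeff_mul_quadric big1 // => j _.
case: ifP => // jm; have [->|jk] := eqVneq j k; first by rewrite bk mul0r.
rewrite rp ?mulr0 // negbK lep_pair_mnm !mnmBE pair_mnm_lshift pair_mnm_rshift.
by rewrite (negPf jk) !subn0 -lep_pair_mnm.
Qed.

(* Replacing b by a k b - b k a removes the variables z_k and w_k from the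
   second quadric, and then reduction modulo the first one, which rewrites
   z_k w_k, commutes with multiplication by the second one. *)
Lemma quadric_regular b u v : (exists l, a k * b l - b k * a l != 0) ->
  u * quadric b = v * quadric a -> exists s, u = s * quadric a.
Proof.
move=> [l ab] E; pose c j := a k * b j - b k * a j.
have qc : quadric c = a k *: quadric b - b k *: quadric a.
  rewrite /quadric !scaler_sumr -sumrB; apply: eq_bigr => j _.
  by rewrite scalerBl !scalerA.
have [s rs] := quadric_division u; exists s; apply/eqP; rewrite -subr_eq0; apply/eqP.
set r := u - _ in rs *.
have : r * quadric c = (a k *: v - b k *: u - s * quadric c) * quadric a.
  rewrite /r !mulrBl -mulrA [quadric a * _]mulrC mulrA; congr (_ - _).
  by rewrite qc mulrBr -!scalerAr E !scalerAl.
have c0 : c k = 0 by rewrite /c mulrC subrr.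
(* [r * quadric c] is both reduced and a multiple of [quadric a], hence zero, while [quadric c] is
   nonzero at the index l. *)
move=> F; have := mul_quadric_reduced c0 rs; rewrite F => /reduced_mul_quadric w0.
move/eqP: F; rewrite w0 mul0r mulf_eq0 quadric_eq0 => /orP[/eqP//|/forallP/(_ l)].
by rewrite (negPf ab).
Qed.

End Division.
End QuadricRegularity.

Lemma sum_ord2 (V : nmodType) (F : 'I_2 -> V) : \sum_i F i = F 0 + F 1.
Proof. by rewrite big_ord_recl big_ord1; congr (_ + F _); apply: val_inj. Qed.

(** * Invariant monomials and the Koszul count for the moment quadrics *)

Section InvariantMonomials.
Variables (n : nat) (A : 'M[int]_(2, n)).
Local Notation mnm := 'X_{1..n + n}.

Definition weightless (m : mnm) : bool :=
  [forall i, \sum_j A i j * ((m (lshift n j))%:Z - (m (rshift n j))%:Z) == 0].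

(** Invariant monomials of degree d - k. Written as a sum, the condition is void for k > d, where
    truncated subtraction would give degree 0. *)
Definition weightless_deg (d k : nat) (m : mnm) : bool :=
  (mdeg m + k == d)%N && weightless m.

Definition mnms_upto (d : nat) : seq mnm := [seq val m | m <- enum {: bmultinom (n + n) d.+1}].

Lemma mnms_upto_uniq d : uniq (mnms_upto d).
Proof. by rewrite map_inj_uniq ?enum_uniq //; exact: val_inj. Qed.

Lemma mem_mnms_upto d m : (m \in mnms_upto d) = (mdeg m <= d)%N.
Proof.
apply/mapP/idP => [[m' _ ->]|md]; first by rewrite -ltnS bmdeg.
by exists (BMultinom (md : (mdeg m < d.+1)%N)); rewrite ?mem_enum.
Qed.

Definition num_weightless (d k : nat) : nat :=
  size [seq m <- mnms_upto d | weightless_deg d k m].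

Lemma weightless_add m j : weightless (m + pair_mnm j)%MM = weightless m.
Proof.
apply: eq_forallb => i; congr (_ == _); apply: eq_bigr => k _; congr (_ * _).
by rewrite !(mnmDE _ m) pair_mnm_lshift pair_mnm_rshift !PoszD opprD addrACA subrr addr0.
Qed.

Lemma weightless_deg_add d k m j :
  weightless_deg d k (m + pair_mnm j)%MM = weightless_deg d k.+2 m.
Proof. by rewrite /weightless_deg weightless_add mdegD mdeg_pair_mnm -addnA add2n. Qed.

Variable K : numFieldType.
Local Notation P := {mpoly K[n + n]}.
Local Notation moment i := (quadric (fun j => (A i j)%:~R : K)).

Definition weightless_poly d k : set P := supported (weightless_deg d k).

Definition moment_ideal : set P :=
  [set p | exists q : 'I_2 -> P, p = \sum_i q i * moment i].

Lemma weightless_poly_subspace d k : subspace (weightless_poly d k).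
Proof. exact: supported_subspace. Qed.

Lemma weightless_poly_basis d k : exists b : 'I_(num_weightless d k) -> P,
  quot_basis (weightless_poly d k) [set 0] b.
Proof.
eexists; apply: supported_basis; first by rewrite filter_uniq // mnms_upto_uniq.
move=> m; rewrite mem_filter mem_mnms_upto.
by case E: (weightless_deg d k m) => //=; case/andP: E => /eqP <-; rewrite leq_addr.
Qed.

Lemma weightless_poly_finite d k (W : set P) : subspace W ->
  exists h (b : 'I_h -> P), quot_basis (weightless_poly d k) W b.
Proof.
move=> sW; pose M : finType := bmultinom (n + n) d.+1.
pose phi (p : P) : 'rV[K]_#|M| := \row_i p@_(bmnm (enum_val i : M)).
exists (quot_dim (weightless_poly d k) W); apply: (quot_dimP (phi := phi)) => //.
- exact: weightless_poly_subspace.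
- by move=> a u v; apply/rowP => i; rewrite !mxE mcoeffD mcoeffZ.
- move=> u du u0; apply/mpolyP => m; rewrite mcoeff0.
  have [md|md] := boolP (mdeg m + k == d)%N; last first.
    by rewrite du // /weightless_deg (negPf md).
  have mlt : (mdeg m < d.+1)%N by rewrite ltnS -(eqP md) leq_addr.
  have /rowP/(_ (enum_rank (BMultinom mlt : M))) := u0.
  by rewrite !mxE enum_rankK.
Qed.

Definition mul_moment i : {linear P -> P} := (moment i \o* idfun).

Lemma mul_momentE i p : mul_moment i p = p * moment i.
Proof. by []. Qed.

Lemma mul_moment_weightless i d k p :
  weightless_poly d k.+2 p -> weightless_poly d k (p * moment i).
Proof.
move=> pE; rewrite -(restrict_id pE) -(@restrict_mul_quadric _ _ (weightless_deg d k)).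
  exact: restrict_supported.
exact: weightless_deg_add.
Qed.

(** The quadrics are invariant of degree 2, so the coefficients of a combination may be cut down to
    their invariant parts of degree d - 2. *)
Lemma moment_ideal_weightless d p : weightless_poly d 0 p ->
  moment_ideal p <-> add_image (add_image [set 0] (mul_moment 0) (weightless_poly d 2))
     (mul_moment 1) (weightless_poly d 2) p.
Proof.
move=> pE; split; last first.
  move=> [w [u [[w' [v [/= -> _ ->]]] _ ->]]]; exists (fun i => if i == 0 then v else u).
  by rewrite sum_ord2 /= add0r.
move=> [q pq]; have rE i : restrict (weightless_deg d 0) (q i * moment i) =
    restrict (weightless_deg d 2) (q i) * moment i.
  by apply: restrict_mul_quadric; exact: weightless_deg_add.
pose r i := restrict (weightless_deg d 2) (q i).
exists (r 0 * moment 0), (r 1); split; last 1 first.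
- rewrite -(restrict_id pE) pq; apply/mpolyP => m; rewrite mcoeffD.
  rewrite -[mul_moment 1 (r 1)]/(r 1 * moment 1) -!rE !mcoeff_restrict /=.
  by rewrite sum_ord2 mcoeffD; case: ifP; rewrite ?addr0.
- by exists 0, (r 0); split; rewrite ?add0r //; exact: restrict_supported.
- exact: restrict_supported.
Qed.

Hypotheses (fA : faithful A) (stA : standard_form A) (n0 : (0 < n)%N).

Lemma moment_neq0 : moment 0 != 0.
Proof.
rewrite quadric_eq0; apply/forallPn; exists (Ordinal n0).
by rewrite intr_eq0 gt_eqF // stA.
Qed.

(** Regularity of the two quadrics in graded form: the cofactor s given by [quadric_regular] is cut
    down to its invariant part of degree d - 4, and a nonzero minor shows that the quadrics are not
    proportional. *)
Lemma moment_regular d u : weightless_poly d 2 u ->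
  add_image [set 0] (mul_moment 0) (weightless_poly d 2) (u * moment 1) <->
  add_image [set 0] (mul_moment 0) (weightless_poly d 4) u.
Proof.
move=> uE; split=> [[w [v [/= -> vE]]]|[w [v [/= -> vE ->]]]]; rewrite !add0r; last first.
  exists 0, (v * moment 1); split; rewrite ?add0r; [by []|exact: mul_moment_weightless|].
  by rewrite mul_momentE mulrAC.
move=> E; pose k := Ordinal n0.
have [l dkl] := exists_minor_neq0 k fA stA.
have ak : (A 0 k)%:~R != 0 :> K by rewrite intr_eq0 gt_eqF // stA.
have [|s us] := @quadric_regular K n (fun j => (A 0 j)%:~R) k ak
    (fun j => (A 1 j)%:~R) u v _ E.
  by exists l; rewrite -!rmorphM -rmorphB intr_eq0.
exists 0, (restrict (weightless_deg d 4) s); split; rewrite ?add0r //.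
  exact: restrict_supported.
rewrite mul_momentE -(@restrict_mul_quadric _ _ (weightless_deg d 2)).
  by rewrite -us restrict_id.
exact: weightless_deg_add.
Qed.

(** The Koszul count N_0 - 2 N_2 + N_4, free of subtraction. It combines the exact sequences for
    multiplication by the first quadric, in degrees d and d - 2, with the one for the second quadric
    modulo the first. *)
Lemma moment_quotient_dim d h (b : 'I_h -> P) :
  quot_basis (weightless_poly d 0) moment_ideal b ->
  (h + 2 * num_weightless d 2 = num_weightless d 0 + num_weightless d 4)%N.
Proof.
move=> Bb.
have s0 := @subspace_set0 K P.
have sW k := weightless_poly_subspace d k.
have sI k : subspace (add_image [set 0] (mul_moment 0) (weightless_poly d k)).
  exact: add_image_subspace.
have step k : exists q (c : 'I_q -> P),
    quot_basis (weightless_poly d k) (add_image [set 0] (mul_moment 0) (weightless_poly d k.+2)) c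
    /\ num_weightless d k = (num_weightless d k.+2 + q)%N.
  have [q [c Bc]] := @weightless_poly_finite d k _ (sI k.+2); exists q, c; split=> //.
  have [b1 B1] := weightless_poly_basis d k; have [b2 B2] := weightless_poly_basis d k.+2.
  apply: (quot_basis_exact (f := mul_moment 0)) B1 B2 Bc => // [p|p _].
    exact: mul_moment_weightless.
  split=> /= [/eqP|->]; last by rewrite mul0r.
  by rewrite mulf_eq0 (negPf moment_neq0) orbF => /eqP.
have [q0 [c0 [B0 E0]]] := step 0%N; have [q2 [c2 [B2 E2]]] := step 2%N.
have := quot_basis_exact (f := mul_moment 1) (sW 0%N) (sI 2%N) (sW 2%N) (sI 4%N) _ _ B0 B2.
move=> /(_ _ b) H.
have -> : (num_weightless d 0 = num_weightless d 2 + (q2 + h))%N.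
  rewrite E0 H //.
  - by move=> p; exact: mul_moment_weightless.
  - exact: moment_regular.
  - by apply: quot_basis_eqW Bb => // p pE; apply: moment_ideal_weightless.
rewrite mul2n -addnn [in RHS]addnAC; move: E2; lia.
Qed.

End InvariantMonomials.

(** * Complex coordinates on real polynomials *)

Lemma digits_inj (B N : nat) (f g : nat -> nat) :
  (forall i, (i < N)%N -> (f i < B)%N) -> (forall i, (i < N)%N -> (g i < B)%N) ->
  (\sum_(i < N) f i * B ^ i = \sum_(i < N) g i * B ^ i)%N ->
  forall i, (i < N)%N -> f i = g i.
Proof.
elim: N f g => [//|N IH] f g fB gB.
rewrite !big_ord_recl /= !expn0 !muln1.
have shift h : (\sum_(i < N) h (bump 0 i) * B ^ bump 0 i =
    (\sum_(i < N) h i.+1 * B ^ i) * B)%N.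
  by rewrite big_distrl /=; apply: eq_bigr => i _; rewrite /bump leq0n add1n expnS mulnA mulnAC.
rewrite !shift => E; have f0 := fB 0%N isT; have g0 := gB 0%N isT.
have B0 : (0 < B)%N by apply: leq_ltn_trans f0.
have E0 : f 0%N = g 0%N.
  by have := congr1 (modn^~ B) E; rewrite ![(_ + _ * B)%N]addnC !modnMDl !modn_small.
have ES := congr1 (divn^~ B) E; rewrite ![(_ + _ * B)%N]addnC !divnMDl ?divn_small // !addn0 in ES.
case=> [//|i] iN; apply: (IH (f \o S) (g \o S)) => //= j jN; [exact: fB|exact: gB].
Qed.

(* Kronecker substitution X_i := T ^ (B ^ i). *)
Lemma mpoly_fun_eq0 (K : numFieldType) N (p : {mpoly K[N]}) :
  (forall v : 'I_N -> K, p.@[v] = 0) -> p = 0.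
Proof.
move=> p0; apply/mpolyP => m; rewrite mcoeff0.
have [mp|/memN_msupp_eq0//] := boolP (m \in msupp p).
(* [B] exceeds all exponents, so [c m] reads them as base-B digits and separates the monomials of
   p. *)
pose B := msize p.
pose c (m : 'X_{1..N}) := (\sum_(i < N) m i * B ^ i)%N.
pose q : {poly K} := \sum_(m <- msupp p) p@_m *: 'X^(c m).
have lB m' : m' \in msupp p -> forall i, (m' i < B)%N.
  move=> m'p i; apply: leq_ltn_trans (msize_mdeg_lt m'p).
  by rewrite mdegE (bigD1 i) //= leq_addr.
have cinj m' : m' \in msupp p -> c m' = c m -> m' = m.
  move=> m'p cE; apply/mnmP => i.
  pose e (f : 'X_{1..N}) (j : nat) := oapp f 0%N (insub j : option 'I_N).
  have eE (f : 'X_{1..N}) (k : 'I_N) : e f k = f k by rewrite /e valK.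
  have eB (f : 'X_{1..N}) : f \in msupp p -> forall j, (j < N)%N -> (e f j < B)%N.
    by move=> fp j jN; rewrite /e insubT /= lB.
  rewrite -!eE; apply: (digits_inj (eB _ m'p) (eB _ mp)) => //.
  by rewrite /c in cE; under eq_bigr do rewrite eE; under [RHS]eq_bigr do rewrite eE.
have q0 : q = 0.
  apply/eqP; apply: contraT => q0.
  have := @max_poly_roots K q [seq (i%:R : K) | i <- iota 0 (size q)] q0.
  rewrite size_map size_iota ltnn; apply=> //; last first.
    by rewrite map_inj_uniq ?iota_uniq // => x y /eqP; rewrite eqr_nat => /eqP.
  apply/allP => x _; rewrite rootE /q horner_sum; apply/eqP.
  rewrite -[RHS](p0 (fun i => x ^+ (B ^ i))) mevalE; apply: eq_bigr => m' _.
  rewrite hornerZ hornerXn /c expr_sum; congr (_ * _); apply: eq_bigr => i _.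
  by rewrite mulnC exprM.
have := congr1 (fun q : {poly K} => q`_(c m)) q0; rewrite coef0 /q coef_sum.
rewrite (bigD1_seq m) ?msupp_uniq //= coefZ coefXn eqxx mulr1 big1_seq ?addr0 //.
move=> m' /andP[m'm m'p]; rewrite coefZ coefXn eq_sym.
case: eqP => [/(cinj _ m'p) E|]; last by rewrite mulr0.
by rewrite E eqxx in m'm.
Qed.

Lemma comp_mpolyA (K : comRingType) n k l (p : {mpoly K[n]})
    (lq : n.-tuple {mpoly K[k]}) (lr : k.-tuple {mpoly K[l]}) :
  (p \mPo lq) \mPo lr = p \mPo [tuple (tnth lq i) \mPo lr | i < n].
Proof.
rewrite [RHS]comp_mpolyEX [X in X \mPo lr]comp_mpolyEX raddf_sum /=.
apply: eq_bigr => m _.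
rewrite comp_mpolyZ !comp_mpolyX rmorph_prod /=; congr (_ *: _).
by apply: eq_bigr => i _; rewrite rmorphXn /= tnth_mktuple.
Qed.

Lemma dhomog_comp (K : comRingType) n k (p : {mpoly K[n]})
    (lq : n.-tuple {mpoly K[k]}) d :
  (forall i, tnth lq i \is 1.-homog) -> p \is d.-homog -> p \mPo lq \is d.-homog.
Proof.
move=> lq1 /dhomogP pd; rewrite comp_mpolyEX big_seq; apply: rpred_sum => m mp.
rewrite rpredZ // comp_mpolyX (_ : d = \sum_i m i)%N; last first.
  by rewrite -mdegE; apply/esym/pd.
apply: (big_rec2 (fun d (q : {mpoly K[k]}) => q \is d.-homog)); first exact: dhomog1.
by move=> i e q _ qe; apply: dhomogM => //; have := dhomogMn (m i) (lq1 i); rewrite mul1n.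
Qed.

Lemma meval_map (K L : comRingType) (f : {rmorphism K -> L}) n (p : {mpoly K[n]}) v :
  (map_mpoly f p).@[f \o v] = f p.@[v].
Proof.
elim/mpolyind: p => [|c m p _ _ IH]; first by rewrite !raddf0.
rewrite !raddfD /= IH; congr (_ + _).
rewrite map_mpolyZ map_mpolyX !mevalZ !mevalX rmorphM rmorph_prod; congr (_ * _).
by apply: eq_bigr => i _; rewrite rmorphXn.
Qed.

Section Complexification.
Variables (R : realType) (n : nat).
Local Notation C := R[i].
Local Notation PR := {mpoly R[n + n]}.
Local Notation PC := {mpoly C[n + n]}.

Definition real_to_zw : (n + n).-tuple PC :=
  [tuple match fintype.split k with
         | inl j => 2^-1 *: ('X_(lshift n j) + 'X_(rshift n j))
         | inr j => (2 * 'i%C)^-1 *: ('X_(lshift n j) - 'X_(rshift n j)) end | k < n + n].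

Definition zw_to_real : (n + n).-tuple PC :=
  [tuple match fintype.split k with
         | inl j => 'X_(lshift n j) + 'i%C *: 'X_(rshift n j)
         | inr j => 'X_(lshift n j) - 'i%C *: 'X_(rshift n j) end | k < n + n].

Lemma complexify_key :
  {f : PR -> PC | forall p, f p = map_mpoly (real_complex R) p \mPo real_to_zw}.
Proof. by exists (fun p => map_mpoly (real_complex R) p \mPo real_to_zw). Qed.

(* Opaque, as failing conversions between explicit polynomials are very slow. *)
Definition complexify : PR -> PC := sval complexify_key.

Lemma complexifyE p : complexify p = map_mpoly (real_complex R) p \mPo real_to_zw.
Proof. exact: (svalP complexify_key). Qed.

Lemma split_lshift (j : 'I_n) : fintype.split (lshift n j) = inl j.
Proof. by rewrite -[lshift n j]/(unsplit (inl j)) unsplitK. Qed.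

Lemma split_rshift (j : 'I_n) : fintype.split (rshift n j) = inr j.
Proof. by rewrite -[rshift n j]/(unsplit (inr j)) unsplitK. Qed.

Lemma comp_mpolyXn k l (lq : k.-tuple {mpoly C[l]}) i : ('X_i : {mpoly C[k]}) \mPo lq = tnth lq i.
Proof. by rewrite comp_mpolyXU -tnth_nth. Qed.

Lemma complexi_neq0 : ('i%C : C) != 0.
Proof. by rewrite -sqrf_eq0 sqr_i oppr_eq0 oner_eq0. Qed.

Lemma scale_half (x : PC) : (2^-1 : C) *: (x + x) = x.
Proof. by rewrite scalerDr -scalerDl -[2^-1]mul1r -splitr scale1r. Qed.

Lemma zw_to_realK q : (q \mPo real_to_zw) \mPo zw_to_real = q.
Proof.
suff E : [tuple tnth real_to_zw i \mPo zw_to_real | i < n + n] = [tuple 'X_i | i < n + n].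
  by rewrite comp_mpolyA E comp_mpoly_id.
apply: eq_from_tnth => k.
rewrite !tnth_mktuple; case: (split_ordP k) => j ->; rewrite comp_mpolyZ.
  rewrite comp_mpolyD !comp_mpolyXn !tnth_mktuple split_lshift split_rshift.
  by rewrite addrACA subrr addr0 scale_half.
rewrite comp_mpolyB !comp_mpolyXn !tnth_mktuple split_lshift split_rshift.
rewrite opprB addrC addrA subrK -scalerDl scalerA -mulr2n -[('i%C : C) *+ 2]mulr_natl.
by rewrite mulVf ?scale1r // mulf_neq0 ?pnatr_eq0 ?complexi_neq0.
Qed.

Lemma real_to_zwK q : (q \mPo zw_to_real) \mPo real_to_zw = q.
Proof.
suff E : [tuple tnth zw_to_real i \mPo real_to_zw | i < n + n] = [tuple 'X_i | i < n + n].
  by rewrite comp_mpolyA E comp_mpoly_id.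
apply: eq_from_tnth => k.
have i2 : ('i%C / (2 * 'i%C) : C) = 2^-1.
  by rewrite invfM mulrCA mulfV ?mulr1 ?complexi_neq0.
rewrite !tnth_mktuple; case: (split_ordP k) => j ->;
  rewrite ?comp_mpolyB ?comp_mpolyD comp_mpolyZ !comp_mpolyXn !tnth_mktuple
    split_lshift split_rshift scalerA i2 -?scalerDr -?scalerBr.
  by rewrite addrACA subrr addr0 scale_half.
by rewrite opprB addrC addrA subrK scale_half.
Qed.

Lemma mcoeff_real_imag (p1 p2 : PR) m :
  (map_mpoly (real_complex R) p1 + 'i%C *: map_mpoly (real_complex R) p2)@_m =
  p1@_m +i* p2@_m.
Proof.
rewrite mcoeffD mcoeffZ [RHS]complexE.
by congr (_ + _ * _); apply: mcoeff_map_mpoly.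
Qed.

Lemma complexifyD p q : complexify (p + q) = complexify p + complexify q.
Proof. by rewrite !complexifyE raddfD comp_mpolyD. Qed.

Lemma complexify0 : complexify 0 = 0.
Proof. by rewrite complexifyE raddf0 comp_mpoly0. Qed.

Lemma complexifyB p q : complexify (p - q) = complexify p - complexify q.
Proof. by rewrite !complexifyE raddfB comp_mpolyB. Qed.

Lemma complexifyM p q : complexify (p * q) = complexify p * complexify q.
Proof. by rewrite !complexifyE !rmorphM. Qed.

Lemma complexifyZ a p : complexify (a *: p) = a%:C *: complexify p.
Proof. by rewrite !complexifyE map_mpolyZ comp_mpolyZ. Qed.

Lemma complexify_sum I (r : seq I) (Q : pred I) (F : I -> PR) :
  complexify (\sum_(i <- r | Q i) F i) = \sum_(i <- r | Q i) complexify (F i).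
Proof.
exact: (big_morph complexify complexifyD complexify0).
Qed.

Lemma complexifyX k : complexify 'X_k = tnth real_to_zw k.
Proof. by rewrite complexifyE map_mpolyX comp_mpolyXn. Qed.

(** With [complexify_inj] this identifies polynomials in z, w with pairs of real polynomials; the
    transfer lemmas below are all stated for such sums. *)
Lemma complexify_onto q : exists p1 p2, q = complexify p1 + 'i%C *: complexify p2.
Proof.
have [r ->] : exists r, q = r \mPo real_to_zw.
  by exists (q \mPo zw_to_real); rewrite real_to_zwK.
have [f fE] : exists f : (C -> R) -> PR, forall g, g 0 = 0 ->
    forall m, (f g)@_m = g r@_m.
  exists (fun g => \sum_(m <- msupp r) g r@_m *: 'X_[m]) => g g0 m.
  rewrite raddf_sum /=; under eq_bigr do rewrite mcoeffZ mcoeffX.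
  have [mr|mr] := boolP (m \in msupp r).
    rewrite (bigD1_seq m) ?msupp_uniq //= eqxx mulr1 big1 ?addr0 // => m' /negPf ->.
    by rewrite mulr0.
  rewrite (memN_msupp_eq0 mr) g0 big1_seq // => m' /= m'r.
  by case: eqP => [E|]; rewrite ?mulr0 //; move: mr; rewrite -E m'r.
exists (f (@complex.Re R)), (f (@complex.Im R)).
suff {1}-> : r = map_mpoly (real_complex R) (f (@complex.Re R)) +
    'i%C *: map_mpoly (real_complex R) (f (@complex.Im R)).
  by rewrite !complexifyE comp_mpolyD comp_mpolyZ.
apply/mpolyP => m; rewrite mcoeff_real_imag !fE //.
by case: (r@_m).
Qed.

Lemma complexify_eq0 p1 p2 : complexify p1 + 'i%C *: complexify p2 = 0 -> p1 = 0 /\ p2 = 0.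
Proof.
rewrite !complexifyE -comp_mpolyZ -comp_mpolyD => /(congr1 (comp_mpoly zw_to_real)).
rewrite zw_to_realK comp_mpoly0 => E.
have coef m : p1@_m = 0 /\ p2@_m = 0.
  by have := mcoeff_real_imag p1 p2 m; rewrite E mcoeff0 => -[<- <-].
by split; apply/mpolyP => m; rewrite mcoeff0; have [] := coef m.
Qed.

Lemma complexify_inj p1 p2 q1 q2 :
  complexify p1 + 'i%C *: complexify p2 = complexify q1 + 'i%C *: complexify q2 ->
  p1 = q1 /\ p2 = q2.
Proof.
move=> E; have E0 : complexify (p1 - q1) + 'i%C *: complexify (p2 - q2) = 0.
  by rewrite !complexifyB scalerBr addrACA -opprD; apply/eqP; rewrite subr_eq0; apply/eqP.
have [h1 h2] := complexify_eq0 E0.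
by split; apply: subr0_eq.
Qed.

Lemma homog1_real_to_zw i : tnth real_to_zw i \is 1.-homog.
Proof.
rewrite tnth_mktuple; case: (fintype.split i) => j; rewrite rpredZ //.
  by rewrite rpredD // dhomogX /= mdeg1.
by rewrite rpredB // dhomogX /= mdeg1.
Qed.

Lemma homog1_zw_to_real i : tnth zw_to_real i \is 1.-homog.
Proof.
rewrite tnth_mktuple; case: (fintype.split i) => j.
  by rewrite rpredD ?rpredZ // dhomogX /= mdeg1.
by rewrite rpredB ?rpredZ // dhomogX /= mdeg1.
Qed.

Lemma complexify_homog p1 p2 d :
  complexify p1 + 'i%C *: complexify p2 \is d.-homog <-> p1 \is d.-homog /\ p2 \is d.-homog.
Proof.
have map_homog p : p \is d.-homog -> map_mpoly (real_complex R) p \is d.-homog.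
  move=> /dhomogP pd; apply/dhomogP => m; rewrite mcoeff_msupp mcoeff_map_mpoly => pm.
  by apply: pd; rewrite mcoeff_msupp; apply: contraNneq pm => ->; rewrite raddf0.
split=> [h|[h1 h2]]; last first.
  by rewrite !complexifyE rpredD ?rpredZ // dhomog_comp ?map_homog // => i; exact: homog1_real_to_zw.
have := dhomog_comp homog1_zw_to_real h.
rewrite !complexifyE -comp_mpolyZ -comp_mpolyD zw_to_realK => hd.
suff coef m : mdeg m != d -> p1@_m = 0 /\ p2@_m = 0.
  split; apply/dhomogP => m; rewrite mcoeff_msupp; apply: contraNeq => /coef[c1 c2].
    by rewrite c1.
  by rewrite c2.
move=> md; have := dhomog_nemf_coeff hd md.
by rewrite mcoeff_real_imag => -[-> ->].
Qed.

Definition zw_point (x : 'rV[C]_n) (k : 'I_(n + n)) : C :=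
  match fintype.split k with inl j => x 0 j | inr j => (x 0 j)^* end.

Lemma zw_pointl x j : zw_point x (lshift n j) = x 0 j.
Proof. by rewrite /zw_point split_lshift. Qed.

Lemma zw_pointr x j : zw_point x (rshift n j) = (x 0 j)^*.
Proof. by rewrite /zw_point split_rshift. Qed.

Lemma meval_complexify p x : (complexify p).@[zw_point x] = (poly_fun p x)%:C.
Proof.
rewrite !complexifyE comp_mpoly_meval /poly_fun.
rewrite -(meval_map (real_complex R)); apply: meval_eq => k.
rewrite tnth_mktuple /real_coord /=; case: (split_ordP k) => j _;
  rewrite mevalZ ?mevalB ?mevalD !mevalXU zw_pointl zw_pointr.
  by rewrite addcJ mulrA mulVf ?mul1r ?pnatr_eq0.
rewrite subcJ mulrAC mulrA mulVf ?mul1r //.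
by rewrite mulf_neq0 ?pnatr_eq0 ?complexi_neq0.
Qed.

Lemma meval_complexify2 p1 p2 x : (complexify p1 + 'i%C *: complexify p2).@[zw_point x] =
  poly_fun p1 x +i* poly_fun p2 x.
Proof.
rewrite mevalD mevalZ (meval_complexify p1).
rewrite (meval_complexify p2).
by rewrite [RHS]complexE.
Qed.

(** Zariski density of the points w = conj z: there the two real components of q are polynomial
    functions on the whole real space. *)
Lemma meval_zw_eq0 q : (forall x, q.@[zw_point x] = 0) -> q = 0.
Proof.
have [p1 [p2 ->]] := complexify_onto q => E.
have fun0 x : poly_fun p1 x = 0 /\ poly_fun p2 x = 0.
  by have := E x; rewrite meval_complexify2 => -[-> ->].
have pE (p : PR) (v : 'I_(n + n) -> R) :
    p.@[v] = poly_fun p (\row_j (v (lshift n j) +i* v (rshift n j))).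
  apply: meval_eq => k; rewrite /real_coord.
  by case: (split_ordP k) => j ->; rewrite mxE ?split_lshift ?split_rshift.
have -> : p1 = 0 by apply: mpoly_fun_eq0 => v; rewrite pE; have [] := fun0 (\row_j (v (lshift n j) +i* v (rshift n j))).
have -> : p2 = 0 by apply: mpoly_fun_eq0 => v; rewrite pE; have [] := fun0 (\row_j (v (lshift n j) +i* v (rshift n j))).
by rewrite complexify0 scaler0 addr0.
Qed.

End Complexification.

(** * The Hilbert function computed in complex coordinates *)

Section HilbertFunction.
Variables (R : realType) (n : nat) (A : 'M[int]_(2, n)).
Local Notation C := R[i].
Local Notation PC := {mpoly C[n + n]}.

Definition torus_weight (i : 'I_2) (m : 'X_{1..n + n}) : int :=
  \sum_j A i j * ((m (lshift n j))%:Z - (m (rshift n j))%:Z).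

Definition torus_char (z : C * C) (m : 'X_{1..n + n}) : C :=
  z.1 ^ torus_weight 0 m * z.2 ^ torus_weight 1 m.

Definition torus_coord (z : C * C) (k : 'I_(n + n)) : C :=
  match fintype.split k with
  | inl j => z.1 ^ A 0 j * z.2 ^ A 1 j
  | inr j => (z.1 ^ A 0 j * z.2 ^ A 1 j)^-1 end.

Lemma unit_norm_neq0 (z : C) : `|z| = 1 -> z != 0.
Proof. by move=> z1; rewrite -normr_eq0 z1 oner_eq0. Qed.

Lemma normr_unit_exprz (z : C) (k : int) : `|z| = 1 -> `|z ^ k| = 1.
Proof.
by move=> z1; rewrite /exprz; case: k => k; rewrite ?normfV normrX z1 expr1n ?invr1.
Qed.

Lemma torus_act_point z x k : torus2 z ->
  zw_point (torus_act A z x) k = torus_coord z k * zw_point x k.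
Proof.
move=> [z1 z2]; rewrite /zw_point /torus_coord; case: (split_ordP k) => j _.
  by rewrite mxE.
rewrite mxE rmorphM; congr (_ * _).
have : `|z.1 ^ A 0 j * z.2 ^ A 1 j| = 1.
  by rewrite normrM !normr_unit_exprz ?mulr1.
by rewrite invc_norm => ->; rewrite expr1n invr1 mul1r.
Qed.

Lemma prod_torus_coord z (m : 'X_{1..n + n}) : torus2 z ->
  \prod_k torus_coord z k ^+ m k = torus_char z m.
Proof.
move=> [/unit_norm_neq0 z1 /unit_norm_neq0 z2].
have zpow (z0 : C) (a : 'I_n -> int) : z0 != 0 -> z0 ^ (\sum_j a j) = \prod_j z0 ^ a j.
  by move=> z00; apply: (big_morph (fun e => z0 ^ e)) => // x y; rewrite expfzDr.
rewrite big_split_ord /= /torus_char /torus_weight !zpow // -!big_split /=.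
apply: eq_bigr => j _; rewrite /torus_coord split_lshift split_rshift.
rewrite !exprnP exprz_inv -expfzDr ?mulf_neq0 ?expfz_neq0 //.
by rewrite expfzMl // !exprz_exp.
Qed.

Lemma meval_torus q z x : torus2 z ->
  q.@[zw_point (torus_act A z x)] =
  \sum_(m <- msupp q) (torus_char z m * q@_m) * \prod_k zw_point x k ^+ m k.
Proof.
move=> Tz; rewrite mevalE; apply: eq_bigr => m _.
under eq_bigr do rewrite torus_act_point // exprMn.
by rewrite big_split /= prod_torus_coord // mulrA [q@_m * _]mulrC.
Qed.

(** In a coordinate of nonzero weight w, a |w|-th root of -1 makes the character equal to -1. *)
Lemma exists_torus_char_neq1 m : ~~ weightless A m ->
  exists2 z, torus2 z & torus_char z m != 1.
Proof.
move=> /forallPn[i wi]; have {wi} : torus_weight i m != 0 := wi; move=> wi.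
have [z z1 zw] : exists2 z : C, `|z| = 1 & z ^ torus_weight i m = -1.
  have : (0 < `|torus_weight i m|)%N by rewrite absz_gt0.
  set w := torus_weight i m; move=> w0.
  pose z : C := (`|w|%N).-root (-1); have zw : z ^+ `|w|%N = -1 by rewrite rootCK.
  exists z.
    by apply/eqP; rewrite -(pexpr_eq1 w0 (normr_ge0 z)) -normrX zw normrN1.
  have [->|->] : w = `|w|%N :> int \/ w = - (`|w|%N : int) by lia.
    by rewrite -exprnP.
  by rewrite -invr_expz -exprnP zw invrN1.
have N1 : (-1 : C) != 1 by rewrite eq_sym -addr_eq0 -[1 + 1]/(2%:R) pnatr_eq0.
have [i0|i1] : i = 0 \/ i = 1.
  by case: (i) => [[|[|]]] //= lp; [left|right]; apply: val_inj.
- exists (z, 1); first by split; rewrite /= ?normr1.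
  by rewrite /torus_char /= exp1rz mulr1 -i0 zw.
- exists (1, z); first by split; rewrite /= ?normr1.
  by rewrite /torus_char /= exp1rz mul1r -i1 zw.
Qed.

(** The torus scales the coefficient at m by [torus_char z m]. By density of the points w = conj z,
    invariance of the function fixes every coefficient, and a nontrivial character kills it. *)
Lemma weightlessP (q : PC) :
  supported (weightless A) q <->
  forall z x, torus2 z -> q.@[zw_point (torus_act A z x)] = q.@[zw_point x].
Proof.
split=> [qw z x Tz|inv m /exists_torus_char_neq1[z Tz zm]].
  rewrite meval_torus // mevalE; apply: eq_big_seq => m; rewrite mcoeff_msupp => qm.
  congr (_ * _); have /forallP w0 : weightless A m.
    by apply: contraR qm => /qw ->.
  by rewrite /torus_char /torus_weight !(eqP (w0 _)) !expr0z !mul1r.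
pose qz : PC := \sum_(m <- msupp q) (torus_char z m * q@_m) *: 'X_[m].
have qzE m' : qz@_m' = torus_char z m' * q@_m'.
  rewrite /qz raddf_sum /=; under eq_bigr do rewrite mcoeffZ mcoeffX.
  have [mr|mr] := boolP (m' \in msupp q).
    rewrite (bigD1_seq m') ?msupp_uniq //= eqxx mulr1 big1 ?addr0 // => m1 /negPf ->.
    by rewrite mulr0.
  rewrite (memN_msupp_eq0 mr) mulr0 big1_seq // => m1 /= m1r.
  by case: eqP => [E|]; rewrite ?mulr0 //; move: mr; rewrite -E m1r.
have : qz - q = 0.
  apply: meval_zw_eq0 => x; rewrite mevalB -(inv z) // meval_torus //.
  rewrite /qz (raddf_sum (meval (zw_point x))) /= -sumrB big1 // => m' _.
  by rewrite mevalZ mevalX subrr.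
move=> /(congr1 (mcoeff m)); rewrite mcoeffB qzE mcoeff0 => /eqP.
rewrite -[X in _ - X]mul1r -mulrBl mulf_eq0 subr_eq0 (negPf zm) /=.
by move/eqP.
Qed.

Lemma complexify_weightless p1 p2 :
  supported (weightless A) (complexify p1 + 'i%C *: complexify p2) <->
  @invariants R n A p1 /\ @invariants R n A p2.
Proof.
split=> [/weightlessP inv|[inv1 inv2]].
  by split=> z x Tz; have := inv z x Tz; rewrite !meval_complexify2 => -[].
apply/weightlessP => z x Tz; rewrite !meval_complexify2.
by congr (_ +i* _); [apply: inv1 | apply: inv2].
Qed.

Lemma complexify_weightless_poly d p1 p2 :
  @weightless_poly n A C d 0 (complexify p1 + 'i%C *: complexify p2) <->
  (@invariants R n A `&` [set p | p \is d.-homog]) p1 /\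
  (@invariants R n A `&` [set p | p \is d.-homog]) p2.
Proof.
set q := complexify p1 + _.
have -> : @weightless_poly n A C d 0 q <-> supported (weightless A) q /\ q \is d.-homog.
  split=> [qd|[qw qd] m].
    split=> [m wm|]; first by apply: qd; rewrite /weightless_deg (negPf wm) andbF.
    apply/dhomogP => m; rewrite mcoeff_msupp; apply: contraNeq => md.
    by rewrite qd // /weightless_deg addn0 (negPf md).
  rewrite /weightless_deg addn0 negb_and => /orP[md|/qw//].
  exact: (dhomog_nemf_coeff qd).
split=> [[/complexify_weightless[i1 i2] /complexify_homog[h1 h2]]|[[i1 h1] [i2 h2]]].
  by split.
by split; [apply/complexify_weightless | apply/complexify_homog].
Qed.

Lemma complexify_moment i :
  complexify (@moment_map R n A i) = 2^-1 *: quadric (fun j => (A i j)%:~R : C).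
Proof.
rewrite /moment_map complexifyZ complexify_sum.
rewrite rmorphV ?unitfE ?pnatr_eq0 // rmorph_nat; congr (_ *: _).
apply: eq_bigr => j _; rewrite complexifyZ rmorph_int; congr (_ *: _).
rewrite complexifyD !expr2 !complexifyM !complexifyX !tnth_mktuple.
rewrite split_lshift split_rshift -!scalerAl -!scalerAr !scalerA.
have i4 : (2 * 'i%C)^-1 * (2 * 'i%C)^-1 = - (2^-1 * 2^-1) :> C.
  by rewrite -!invfM mulrACA -[_ * 'i%C]expr2 sqr_i mulrN1 invrN.
rewrite i4 scaleNr -scalerBr /pair_mnm mpolyXD.
move: 'X_(lshift n j) 'X_(rshift n j) => a b.
have -> : (a + b) * (a + b) - (a - b) * (a - b) = (a * b) *+ 4 by ring.
rewrite -scalerMnr scalerMnl -[RHS]scale1r; congr (_ *: _).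
by rewrite -mulr_natr; field.
Qed.

Lemma complexify_shell_ideal p1 p2 :
  moment_ideal A (complexify p1 + 'i%C *: complexify p2) <->
  @shell_ideal R n A p1 /\ @shell_ideal R n A p2.
Proof.
split=> [[q E]|[[r ->] [s ->]]].
  have /choice[f fE] i : exists p : {mpoly R[n + n]} * {mpoly R[n + n]},
      q i = complexify p.1 + 'i%C *: complexify p.2.
    by have [r [s ->]] := complexify_onto (q i); exists (r, s).
  have : complexify p1 + 'i%C *: complexify p2 =
     complexify (\sum_i (2 *: (f i).1) * @moment_map R n A i) +
     'i%C *: complexify (\sum_i (2 *: (f i).2) * @moment_map R n A i).
    rewrite E !complexify_sum scaler_sumr -big_split /=; apply: eq_bigr => i _.
    rewrite fE !complexifyM complexify_moment !complexifyZ rmorph_nat.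
    rewrite -!scalerAl -!scalerAr !scalerA mulfV ?pnatr_eq0 //.
    by rewrite -mulrA mulfV ?pnatr_eq0 // mulr1 scale1r mulrDl -scalerAl.
  by move=> /complexify_inj[-> ->]; split; eexists.
exists (fun i => 2^-1 *: (complexify (r i) + 'i%C *: complexify (s i))).
rewrite !complexify_sum scaler_sumr -big_split /=; apply: eq_bigr => i _.
rewrite !complexifyM complexify_moment -!scalerAr -scalerAl mulrDl scalerDr.
by rewrite -scalerAl !scalerA [2^-1 * _]mulrC.
Qed.

(** Extension of scalars preserves the dimension: a complexified real basis stays a basis, since
    membership in the invariants and in the ideal is tested on real and imaginary parts
    separately. *)
Lemma hilb_on_basis d : exists b : 'I_(hilb_on R A d) -> PC,
  quot_basis (@weightless_poly n A C d 0) (@moment_ideal n A C) b.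
Proof.
have [b Bb] := hilb_onP R A d; exists (fun i => complexify (b i)).
have [I0 ID] := invariants_subspace R A.
have sU : subspace (@invariants R n A `&` [set p | p \is d.-homog]).
  split; first by split=> //=; exact: dhomog0.
  by move=> a u v [Iu du] [Iv dv]; split; [exact: ID | rewrite /= rpredD ?rpredZ].
have sW := shell_ideal_inv_subspace R A.
have sI : subspace (@moment_ideal n A C).
  split; first by exists (fun=> 0); rewrite big1 // => i _; rewrite mul0r.
  move=> a u v [q ->] [q' ->]; exists (fun i => a *: q i + q' i).
  by rewrite scaler_sumr -big_split /=; apply: eq_bigr => i _; rewrite mulrDl scalerAl.
have sumE (c : 'rV[C]_(hilb_on R A d)) : \sum_i c 0 i *: complexify (b i) =
    complexify (\sum_i (\row_j complex.Re (c 0 j)) 0 i *: b i) +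
    'i%C *: complexify (\sum_i (\row_j complex.Im (c 0 j)) 0 i *: b i).
  rewrite !complexify_sum scaler_sumr -big_split /=; apply: eq_bigr => i _.
  by rewrite !mxE !complexifyZ scalerA -scalerDl -complexE.
apply: quot_basisI => //.
- move=> i; have := complexify_weightless_poly d (b i) 0.
  rewrite complexify0 scaler0 addr0 => H; apply/H; split; last by apply: sU.1.
  exact: Bb.1.
- move=> u; have [p1 [p2 ->]] := complexify_onto u.
  move=> /complexify_weightless_poly[U1 U2].
  have [c1 [[W1 _] _]] := Bb.2 _ U1; have [c2 [[W2 _] _]] := Bb.2 _ U2.
  exists (\row_i (c1 0 i +i* c2 0 i)); rewrite sumE opprD addrACA -scalerBr -!complexifyB.
  apply/complexify_shell_ideal; split.
    by move: W1; congr (@shell_ideal _ _ _ (_ - _)); apply: eq_bigr => i _; rewrite !mxE.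
  by move: W2; congr (@shell_ideal _ _ _ (_ - _)); apply: eq_bigr => i _; rewrite !mxE.
- move=> c; rewrite sumE => /complexify_shell_ideal[W1 W2].
  have free (x : 'rV[R]_(hilb_on R A d)) : @shell_ideal R n A (\sum_i x 0 i *: b i) -> x = 0.
    move=> Wx; apply: (quot_basis_free sU sW Bb); split=> //.
    have := subspace_sum (fun i => x 0 i) sU Bb.1; by case.
  apply/rowP => i; rewrite mxE [c 0 i]complexE.
  have /rowP/(_ i) := free _ W1; have /rowP/(_ i) := free _ W2.
  by rewrite !mxE => -> ->; rewrite mulr0 addr0.
Qed.

End HilbertFunction.

(** * Complex series *)

(** In the partial order of R[i], [0 < e] forces e to be real, so real radii suffice. *)
Lemma ccvgP (R : realType) (u : nat -> R[i]^o) (l : R[i]^o) :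
  u @ \oo --> l <->
  forall e : R, 0 < e -> exists N, forall n, (N <= n)%N -> `|u n - l| < e%:C :> R[i].
Proof.
split=> [/cvgrPdist_lt H e e0|H].
  have [|N _ HN] := H e%:C; first by rewrite ltcR.
  by exists N => n Nn; rewrite distrC; exact: HN.
apply/cvgrPdist_lt => e; rewrite ltcE => /andP[/eqP ime ree].
have [N HN] := H _ ree; exists N => // n /= Nn.
rewrite distrC; apply: lt_le_trans (HN n Nn) _.
by rewrite lecE /= ime eqxx lexx.
Qed.

Lemma big_subseq_split (V : nmodType) (I : eqType) (s s' : seq I) (F : I -> V) :
  uniq s -> uniq s' -> {subset s <= s'} ->
  \sum_(x <- s') F x = \sum_(x <- s) F x + \sum_(x <- s' | x \notin s) F x.
Proof.
move=> us us' ss'; rewrite (bigID (mem s)) /=; congr (_ + _).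
rewrite -big_filter; apply: perm_big; apply: uniq_perm => //; first exact: filter_uniq.
by move=> x; rewrite mem_filter; case xs: (x \in s) => //=; rewrite ss'.
Qed.

(** Absolute convergence makes the limit independent of the exhaustion. The bound is asked of [s]
    only, as each [s' n] lies in some [s m]. *)
Lemma exhaustion_cvg (R : realType) (I : eqType) (f : I -> R[i]) (g : I -> R)
    (s s' : nat -> seq I) (l : R[i]^o) (B : R) :
  (forall x, `|f x| <= (g x)%:C) ->
  (forall n, uniq (s n)) -> (forall n, uniq (s' n)) ->
  (forall m n, (m <= n)%N -> {subset s m <= s n}) ->
  (forall m n, (m <= n)%N -> {subset s' m <= s' n}) ->
  (forall n, exists m, {subset s n <= s' m}) ->
  (forall n, exists m, {subset s' n <= s m}) ->
  (forall n, \sum_(x <- s n) g x <= B) ->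
  (fun n => \sum_(x <- s n) f x : R[i]^o) @ \oo --> l ->
  (fun n => \sum_(x <- s' n) f x : R[i]^o) @ \oo --> l.
Proof.
move=> fg us us' sm sm' ss' s's AB /ccvgP fl.
have g0 x : 0 <= g x by rewrite -lecR; apply: le_trans (fg x); exact: normr_ge0.
pose A n := \sum_(x <- s n) g x.
have Ale u v : uniq u -> uniq v -> {subset u <= v} ->
    \sum_(x <- u) g x <= \sum_(x <- v) g x.
  by move=> uu uv uv'; rewrite (big_subseq_split g uu uv uv') lerDl sumr_ge0.
have And : {homo A : n m / (n <= m)%N >-> n <= m}.
  by move=> n m nm; apply: Ale => //; exact: sm.
have Acvg : cvgn A.
  by apply: nondecreasing_is_cvgn => //; exists B => _ [n _ <-]; exact: AB.
have Aa n : A n <= limn A by apply: nondecreasing_cvgn_le.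
apply/ccvgP => e e0; have e20 : 0 < e / 2 by rewrite divr_gt0.
have [N1 HN1] := fl _ e20.
move/cvgrPdist_lt : Acvg => /(_ _ e20)[N2 _ HN2].
pose N := maxn N1 N2; have [M sM] := ss' N; exists M => m Mm.
have sNm : {subset s N <= s' m} by move=> x /sM; exact: sm'.
have [k sk] := s's m.
(* The terms of [s' m] outside [s N] lie in [s k], so their majorant is at most the tail
   [limn A - A N]. *)
rewrite (big_subseq_split f (us N) (us' m) sNm) addrAC.
apply: le_lt_trans (ler_normD _ _) _.
rewrite [e]splitr rmorphD /=; apply: ltr_leD; first by apply: HN1; rewrite leq_maxl.
apply: le_trans (ler_norm_sum _ _ _) _.
apply: (@le_trans _ _ (\sum_(x <- s' m | x \notin s N) (g x)%:C)).
  by apply: ler_sum => x _; exact: fg.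
rewrite -rmorph_sum lecR.
have h1 := big_subseq_split g (us N) (us' m) sNm.
have h2 := Ale _ _ (us' m) (us k) sk.
have h3 := Aa k; have := HN2 N (leq_maxr _ _) => /=.
rewrite ger0_norm ?subr_ge0 //; move: h1 h2 h3; rewrite /A; lra.
Qed.

Section ComplexSeries.
Variable R : realType.
Local Notation C := R[i].

Lemma norm_realE (z : C) : `|z| = (complex.Re `|z|)%:C.
Proof. by rewrite RRe_real // normr_real. Qed.

Lemma cvg_cexpr (x : C) : `|x| < 1 -> (fun n => x ^+ n : C^o) @ \oo --> (0 : C^o).
Proof.
rewrite norm_realE -[1]/(1%:C) ltcR; set r := complex.Re _ => r1.
have r0 : 0 <= r by rewrite -lecR /r -norm_realE normr_ge0.
have rr : `|r| < 1 by rewrite ger0_norm.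
have /cvgrPdist_lt H := cvg_expr rr.
apply/ccvgP => e /H[N _ HN]; exists N => n /HN /=.
rewrite sub0r normrN ger0_norm ?exprn_ge0 // -ltcR subr0 normrX.
by rewrite [`|x|]norm_realE rmorphXn.
Qed.

Lemma cvg_geometric_sum (x : C) : `|x| < 1 ->
  (fun n => \sum_(m < n) x ^+ m : C^o) @ \oo --> ((1 - x)^-1 : C^o).
Proof.
move=> x1; have x1N : 1 - x != 0.
  by rewrite subr_eq0; apply: contraTneq x1 => <-; rewrite normr1 ltxx.
rewrite (_ : (fun n => _) = fun n => (1 - x ^+ n) * (1 - x)^-1 : C^o).
  rewrite -[X in _ --> X](mul1r (1 - x)^-1); apply: cvgM; last exact: cvg_cst.
  rewrite -[X in _ --> X](subr0 1); apply: cvgB; first exact: cvg_cst.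
  exact: cvg_cexpr.
apply/funext => n; apply: (mulIf x1N); rewrite divfK //.
by rewrite -[RHS]opprB subrX1 -mulNr opprB mulrC.
Qed.

Lemma contraction_cvg0 (x : nat -> R) (q : R) (delta : nat -> R) :
  0 <= q < 1 -> (forall n, 0 <= x n) ->
  (forall n, x n.+2 <= q * x n + delta n) ->
  delta @ \oo --> (0 : R) -> x @ \oo --> (0 : R).
Proof.
move=> /andP[q0 q1] x0 xq /cvgrPdist_lt d0; apply/cvgrPdist_lt => e e0.
have e20 : 0 < e / 2 by rewrite divr_gt0.
(* With this margin e / 2 is the fixed point of x |-> q x + (1 - q) e / 2, so the excess over it
   shrinks by q every two steps. [M] below bounds both starting values; its summand 1 allows
   division by it. *)
have [|N _ HN] := d0 ((1 - q) * (e / 2)); first by rewrite mulr_gt0 // subr_gt0.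
pose M := x N + x N.+1 + 1.
have M0 : 0 < M by rewrite /M; have := x0 N; have := x0 N.+1; lra.
have step k : x (N + k)%N - e / 2 <= q ^+ k./2 * M.
  suff : x (N + k)%N - e / 2 <= q ^+ k./2 * M /\ x (N + k.+1)%N - e / 2 <= q ^+ (k.+1)./2 * M.
    by case.
  elim: k => [|k [IH1 IH2]].
    by rewrite addn0 addn1 /= expr0 mul1r /M; have := x0 N; have := x0 N.+1; split; lra.
  split=> //; rewrite /= exprS -mulrA.
  have := HN (N + k)%N (leq_addr _ _); rewrite /= sub0r normrN => /ltr_normlW dk.
  have := xq (N + k)%N; rewrite !addnS.
  have := ler_wpM2l q0 IH1; lra.
have q1' : `|q| < 1 by rewrite ger0_norm.
have /cvgrPdist_lt/(_ (e / 2 / M)) := cvg_expr q1'.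
case; first by rewrite divr_gt0.
move=> K _ HK; exists (N + K.*2)%N => // n /= nN.
rewrite sub0r normrN ger0_norm //.
have nE : n = (N + (n - N))%N by lia.
have := step (n - N)%N; rewrite -nE.
have kK : (K <= (n - N)./2)%N by lia.
have := HK _ kK; rewrite /= sub0r normrN ger0_norm ?exprn_ge0 //.
rewrite ltr_pdivlMr //; lra.
Qed.

(** The coefficients of 1 - X^2 times the power series of b. *)
Definition delta2 (b : nat -> C) (m : nat) : C :=
  b m - (if m is m'.+2 then b m' else 0).

(** Convergence for b is part of the conclusion: the partial sums satisfy B(n+2) = A(n+2) + t^2
    B(n), so their distance to the fixed point s / (1 - t^2) contracts up to an error tending to
    0. *)
Lemma delta2_series (b : nat -> C) (t s : C) : `|t| < 1 ->
  (fun n => \sum_(m < n) delta2 b m * t ^+ m : C^o) @ \oo --> (s : C^o) ->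
  (fun n => \sum_(m < n) b m * t ^+ m : C^o) @ \oo --> (s / (1 - t ^+ 2) : C^o).
Proof.
move=> t1 As; pose Bn n := \sum_(m < n) b m * t ^+ m.
pose An n := \sum_(m < n) delta2 b m * t ^+ m.
have t2 : `|t ^+ 2| < 1 by rewrite normrX expr_lt1.
have t2N : 1 - t ^+ 2 != 0.
  by rewrite subr_eq0; apply: contraTneq t2 => <-; rewrite normr1 ltxx.
have AB n : Bn n.+2 = An n.+2 + t ^+ 2 * Bn n.
  rewrite /An /delta2; under eq_bigr do rewrite mulrBl.
  rewrite sumrB -/(Bn n.+2) -addrA -[LHS]addr0; congr (_ + _).
  rewrite 2!big_ord_recl /= !mul0r !add0r /Bn mulr_sumr -sumrN -big_split /=.
  by rewrite big1 // => i _; rewrite /bump !leq0n !add1n -[i.+2]addn2 exprD; ring.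
pose l := s / (1 - t ^+ 2).
pose x n := complex.Re `|Bn n - l|; pose q := complex.Re `|t ^+ 2|.
pose dl n := complex.Re `|An n.+2 - s|.
suff /cvgrPdist_lt x0 : x @ \oo --> (0 : R).
  apply/ccvgP => e /x0[N _ HN]; exists N => n /HN /=.
  rewrite sub0r normrN -ltcR => H; rewrite norm_realE; apply: le_lt_trans H.
  by rewrite lecR ler_norm.
have Re_ge0 (z : C) : 0 <= complex.Re `|z| by rewrite -lecR -norm_realE; exact: normr_ge0.
apply: (@contraction_cvg0 x q dl).
- by rewrite Re_ge0 /= -ltcR -norm_realE.
- by move=> n; exact: Re_ge0.
- move=> n; rewrite -lecR rmorphD rmorphM /= -!norm_realE -normrM.
  rewrite (_ : Bn n.+2 - l = t ^+ 2 * (Bn n - l) + (An n.+2 - s)) ?ler_normD //.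
  rewrite AB /l; by field.
apply/cvgrPdist_lt => e e0; move/ccvgP: As => /(_ _ e0)[N HN].
exists N => // n /= Nn; have := HN n.+2 (leq_trans Nn (leq_trans (leqnSn _) (leqnSn _))).
by rewrite norm_realE ltcR sub0r normrN [`|dl n|]ger0_norm //; exact: Re_ge0.
Qed.

End ComplexSeries.

(** * Counting kernel vectors *)

Section CountingWeightless.
Variables (n : nat) (A : 'M[int]_(2, n)).
Local Notation mnm := 'X_{1..n + n}.

Definition in_kernel (g : {ffun 'I_n -> int}) : bool :=
  [forall i, \sum_k A i k * g k == 0].

Definition norm1 (g : {ffun 'I_n -> int}) : nat := (\sum_k `|g k|)%N.

(** This interpolates between all monomials (s = 0) and, for s = n, those given by the positive and
    negative parts of an integer vector. *)
Definition pair_free (s : nat) (m : mnm) : bool :=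
  [forall j : 'I_n, (j < s)%N ==> ((m (lshift n j) == 0%N) || (m (rshift n j) == 0%N))].

Definition num_pair_free (s d : nat) : nat :=
  size [seq m <- mnms_upto n d | weightless_deg A d 0 m && pair_free s m].

Lemma num_weightlessE d k :
  num_weightless A d k = if (k <= d)%N then num_pair_free 0 (d - k) else 0%N.
Proof.
have pf0 m : pair_free 0 m by apply/forallP.
case: leqP => kd.
  apply: perm_size; apply: uniq_perm; rewrite ?filter_uniq ?mnms_upto_uniq // => m.
  rewrite !mem_filter !mem_mnms_upto pf0 /weightless_deg andbT addn0.
  case: (weightless A m); rewrite ?andbF //= !andbT; lia.
apply/eqP; rewrite size_eq0 -[_ == _]negbK -has_filter -all_predC.
by apply/allP => m _ /=; rewrite /weightless_deg negb_and; apply/orP; left; lia.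
Qed.

(** Monomials divisible by z_s w_s are divided by it, which keeps invariance and the conditions for
    j < s. On generating series, passing from s + 1 to s divides by 1 - t^2. *)
Lemma num_pair_free_step s d (sn : (s < n)%N) :
  num_pair_free s d =
  (num_pair_free s.+1 d + (if d is d'.+2 then num_pair_free s d' else 0))%N.
Proof.
pose j := Ordinal sn.
pose Q (m : mnm) := (pair_mnm j <= m)%MM.
have QE (m : mnm) : ~~ Q m = (m (lshift n j) == 0%N) || (m (rshift n j) == 0%N).
  by rewrite /Q lep_pair_mnm negb_and -!leqNgt !leqn0.
have pfS m : pair_free s m && ~~ Q m = pair_free s.+1 m.
  rewrite QE; apply/andP/forallP => [[/forallP pf mj] k|pf].
    apply/implyP; rewrite ltnS leq_eqVlt => /orP[/eqP ks|ks].
      by rewrite (_ : k = j) //; apply: val_inj.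
    by move/implyP: (pf k); exact.
  split; last by have /implyP := pf j; apply; rewrite /= ltnSn.
  by apply/forallP => k; apply/implyP => ks; have /implyP := pf k; apply; exact: ltnW.
rewrite /num_pair_free size_filter -sum1_count (bigID Q) /= addnC; congr (_ + _)%N.
  rewrite size_filter -sum1_count; apply: eq_bigl => m.
  by rewrite -andbA pfS.
have pf_add m : pair_free s (m + pair_mnm j)%MM = pair_free s m.
  apply: eq_forallb => k; case: ltnP => //= ks.
  rewrite !(mnmDE _ m) pair_mnm_lshift pair_mnm_rshift (_ : j == k = false) ?addn0 //.
  by apply/negbTE; rewrite -val_eqE /= neq_ltn ks orbT.
case: d => [|[|d]]; rewrite ?sum1_count -?size_filter.
- apply/eqP; rewrite size_eq0 -[_ == _]negbK -has_filter -all_predC.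
  apply/allP => m; rewrite mem_mnms_upto leqn0 mdeg_eq0 => /eqP -> /=.
  by rewrite /Q lep_pair_mnm mnm0E !andbF.
- apply/eqP; rewrite size_eq0 -[_ == _]negbK -has_filter -all_predC.
  apply/allP => m; rewrite mem_mnms_upto => m1 /=.
  case Qm: (Q m); rewrite ?andbF //.
  by move: m1; rewrite -(submK Qm) mdegD mdeg_pair_mnm addn2.
rewrite -[RHS](size_map (fun m => (m + pair_mnm j)%MM)); apply: perm_size; apply: uniq_perm.
- by rewrite filter_uniq ?mnms_upto_uniq.
- rewrite map_inj_uniq ?filter_uniq ?mnms_upto_uniq // => x y; exact: addIm.
move=> m; apply/idP/mapP => [|[m' + ->]].
  rewrite mem_filter mem_mnms_upto => /andP[/andP[/andP[wm pm] Qm] md].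
  exists (m - pair_mnm j)%MM; last by rewrite submK.
  rewrite -(submK Qm) pf_add in pm; rewrite -(submK Qm) weightless_deg_add in wm.
  rewrite mem_filter mem_mnms_upto pm andbT; move: wm.
  rewrite /weightless_deg addn2 addn0 eqSS eqSS => /andP[/eqP wd ->].
  by rewrite wd eqxx leqnn.
rewrite !mem_filter !mem_mnms_upto pf_add weightless_deg_add /Q lem_addl.
rewrite mdegD mdeg_pair_mnm /weightless_deg addn2 addn0 => /andP[/andP[/andP[/eqP <- ->] ->] _].
by rewrite ?addn2 ?eqxx ?leqnn.
Qed.

Definition kernel_vec (m : mnm) : {ffun 'I_n -> int} :=
  [ffun j => (m (lshift n j))%:Z - (m (rshift n j))%:Z].

Lemma pair_freeP (m : mnm) : reflect
  (forall j, m (lshift n j) = 0%N \/ m (rshift n j) = 0%N) (pair_free n m).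
Proof.
apply: (iffP forallP) => [pf j|pf j].
  by have := pf j; rewrite ltn_ord => /orP[/eqP|/eqP]; [left|right].
by apply/implyP => _; apply/orP; case: (pf j) => ->; [left|right].
Qed.

Lemma kernel_vec_inj : {in pair_free n &, injective kernel_vec}.
Proof.
move=> m m' /pair_freeP pf /pair_freeP pf' /ffunP E; apply/mnmP => k.
by case: (split_ordP k) => j ->; have := E j; rewrite !ffunE;
  case: (pf j) => ->; case: (pf' j) => ->; lia.
Qed.

Lemma kernel_vec_norm1 m : pair_free n m -> norm1 (kernel_vec m) = mdeg m.
Proof.
move=> /pair_freeP pf; rewrite mdegE big_split_ord /= -big_split /=.
apply: eq_bigr => j _; rewrite ffunE.
by case: (pf j) => ->; lia.
Qed.

Lemma kernel_vec_in_kernel m : in_kernel (kernel_vec m) = weightless A m.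
Proof. by apply: eq_forallb => i; under eq_bigr do rewrite ffunE. Qed.

Lemma kernel_vec_onto g : exists2 m, pair_free n m & kernel_vec m = g.
Proof.
pose m : mnm := [multinom match fintype.split k with
  | inl j => if (0 <= g j)%R then `|g j|%N else 0%N
  | inr j => if (0 <= g j)%R then 0%N else `|g j|%N end | k < n + n].
have ml j : m (lshift n j) = if (0 <= g j)%R then `|g j|%N else 0%N.
  by rewrite mnmE split_lshift.
have mr j : m (rshift n j) = if (0 <= g j)%R then 0%N else `|g j|%N.
  by rewrite mnmE split_rshift.
exists m; first by apply/pair_freeP => j; rewrite ml mr; case: ifP; [right|left].
by apply/ffunP => j; rewrite ffunE ml mr; move: (g j) => x; case: leP; lia.
Qed.

(** Listed through monomials, which are finitely many in bounded degree; the strict bound matches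
    partial sums over [d < N]. *)
Definition kernel_ball (N : nat) : seq {ffun 'I_n -> int} :=
  [seq kernel_vec m | m <- mnms_upto n N & [&& (mdeg m < N)%N, weightless A m & pair_free n m]].

Lemma kernel_ball_uniq N : uniq (kernel_ball N).
Proof.
rewrite map_inj_in_uniq ?filter_uniq ?mnms_upto_uniq // => x y.
by rewrite !mem_filter => /andP[/and3P[_ _ px] _] /andP[/and3P[_ _ py] _]; apply: kernel_vec_inj.
Qed.

Lemma mem_kernel_ball N g : (g \in kernel_ball N) = in_kernel g && (norm1 g < N)%N.
Proof.
apply/mapP/andP => [[m + ->]|[gk gN]].
  rewrite mem_filter => /andP[/and3P[mN wm pm] _].
  by rewrite kernel_vec_in_kernel kernel_vec_norm1.
have [m pm gE] := kernel_vec_onto g; exists m => //.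
move: gk gN; rewrite -gE kernel_vec_in_kernel kernel_vec_norm1 // => wm mN.
by rewrite mem_filter mem_mnms_upto mN wm pm ltnW.
Qed.

Lemma kernel_ball_series (F : pzRingType) (t : F) N :
  \sum_(d < N) (num_pair_free n d)%:R * t ^+ d = \sum_(g <- kernel_ball N) t ^+ norm1 g.
Proof.
rewrite big_map big_filter.
rewrite (eq_bigr (fun m => t ^+ mdeg m)); last first.
  by move=> m /and3P[_ _ pm]; rewrite kernel_vec_norm1.
(* A separate bound [T] keeps the enumerated list fixed during the induction on N. *)
suff gen T : (N <= T)%N -> \sum_(d < N) (num_pair_free n d)%:R * t ^+ d =
    \sum_(m <- mnms_upto n T | [&& (mdeg m < N)%N, weightless A m & pair_free n m]) t ^+ mdeg m.
  exact: gen.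
elim: N => [|N IH] NT; first by rewrite big_ord0 big_pred0.
rewrite big_ord_recr /= (IH (ltnW NT)) [RHS](bigID (fun m => mdeg m < N)%N) /=.
congr (_ + _).
  apply: eq_bigl => m; case: (ltnP (mdeg m) N) => mN; rewrite ?andbF //=.
  by rewrite andbT (leq_trans mN).
rewrite (eq_bigl (fun m => weightless_deg A N 0 m && pair_free n m)); last first.
  move=> m; rewrite /weightless_deg addn0.
  case: (weightless A m); case: (pair_free n m); rewrite ?andbF ?andbT //=.
  by apply/idP/idP; lia.
rewrite (eq_bigr (fun=> t ^+ N)); last first.
  by move=> m /andP[/andP[/eqP + _] _]; rewrite addn0 => ->.
rewrite -big_filter big_const_seq count_predT iter_addr_0 mulr_natl; congr (_ *+ _).
apply: perm_size; apply: uniq_perm; rewrite ?filter_uniq ?mnms_upto_uniq // => m.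
rewrite !mem_filter !mem_mnms_upto /weightless_deg addn0.
case: eqP => //= ->; by rewrite leqnn (ltnW NT).
Qed.

End CountingWeightless.

Lemma eq_ccvg (R : realType) (u v : nat -> R[i]^o) (l : R[i]^o) :
  u =1 v -> u @ \oo --> l -> v @ \oo --> l.
Proof. by move/funext ->. Qed.

Lemma ccvg_lim_eq (R : realType) (u : nat -> R[i]^o) (l l' : R[i]^o) :
  l = l' -> u @ \oo --> l -> u @ \oo --> l'.
Proof. by move=> ->. Qed.

(** * From the Hilbert function to the sum over the kernel *)

Section HilbertSeries.
Variables (R : realType) (n : nat) (A : 'M[int]_(2, n)).
Hypotheses (n1 : (1 < n)%N) (fA : faithful A) (stA : standard_form A).

(** Dividing out the two quadrics and forbidding z_j w_j for the first two indices both multiply the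
    series by (1 - t^2)^2. The relations reach back four degrees, whence the five cases. *)
Lemma hilb_onE d : hilb_on R A d = num_pair_free A 2 d.
Proof.
have [b Bb] := hilb_on_basis R A d.
have := moment_quotient_dim fA stA (ltnW n1) Bb.
rewrite !num_weightlessE subn0 leq0n.
have s0 := num_pair_free_step A _ (ltnW n1); have s1 := num_pair_free_step A _ n1.
case: d {b Bb} => [|[|[|[|d]]]] /=; rewrite ?subSS ?subn0.
- have := s0 0%N; have := s1 0%N; lia.
- have := s0 1%N; have := s1 1%N; lia.
- have := s0 2%N; have := s1 2%N; have := s0 0%N; lia.
- have := s0 3%N; have := s1 3%N; have := s0 1%N; lia.
- have := s0 d.+4; have := s1 d.+4; have := s0 d.+2; lia.
Qed.

Lemma hilbert_series (t s : R[i]) : `|t| < 1 ->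
  (fun N => \sum_(g <- kernel_ball A N) t ^+ norm1 g : R[i]^o) @ \oo -->
    (s * (1 - t ^+ 2) ^+ (n - 2) : R[i]^o) ->
  (fun N => \sum_(d < N) (hilb_on R A d)%:R * t ^+ d : R[i]^o) @ \oo --> (s : R[i]^o).
Proof.
move=> t1; have qN0 : (1 - t ^+ 2) ^+ (n - 2) != 0.
  rewrite expf_neq0 // subr_eq0 eq_sym; apply: contraTneq t1 => t2.
  by rewrite -(expr_lt1 (ltn0Sn 1) (normr_ge0 t)) -normrX t2 normr1 ltxx.
rewrite -[s in X in _ -> X](mulfK qN0); move: (s * _) => {qN0} s1 Ks.
(* Each step lifts one restriction at the cost of a factor 1 - t^2 in the denominator, from kernel
   vectors (k = 0) to the Hilbert function (k = n - 2). *)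
suff gen k : (k <= n)%N ->
    (fun N => \sum_(d < N) (num_pair_free A (n - k) d)%:R * t ^+ d : R[i]^o) @ \oo -->
    (s1 / (1 - t ^+ 2) ^+ k : R[i]^o).
  apply: eq_ccvg (gen (n - 2)%N (leq_subr _ _)) => N.
  by apply: eq_bigr => d _; rewrite hilb_onE subKn.
elim: k => [_|k IH kn].
  by rewrite expr0 divr1; apply: eq_ccvg Ks => N; rewrite subn0 kernel_ball_series.
rewrite exprSr invfM mulrA; apply: (@delta2_series _ (fun d => (num_pair_free A (n - k.+1) d)%:R) _ _ t1).
have IHk := IH (ltnW kn).
apply: (eq_ccvg _ IHk) => N.
apply: eq_bigr => d _.
have kS : (n - k = (n - k.+1).+1)%N by lia.
rewrite /delta2 (num_pair_free_step A d (_ : (n - k.+1 < n)%N)); last by lia.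
rewrite kS natrD; case: (nat_of_ord d) => [|[|e]]; rewrite ?addr0 ?subr0 //.
by rewrite addrK.
Qed.

End HilbertSeries.

(** * Poisson kernels and roots of unity *)

Lemma sum_sym_range (V : comRingType) (F : int -> V) N :
  \sum_(c < (N + N).+1) F ((c : nat)%:Z - N%:Z) =
  F 0 + \sum_(m < N) (F m.+1%:Z + F (- m.+1%:Z)).
Proof.
elim: N F => [|N IH] F; first by rewrite big_ord_recl !big_ord0 subrr.
transitivity (F (- N.+1%:Z) + \sum_(c < (N + N).+1) F ((c : nat)%:Z - N%:Z) + F N.+1%:Z).
  rewrite addSn addnS big_ord_recr big_ord_recl /= sub0r; congr (_ + _ + F _); last by lia.
  by apply: eq_bigr => c _; congr F; rewrite /bump leq0n; lia.
by rewrite IH big_ord_recr /=; ring.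
Qed.

Section PoissonSeries.
Variable R : realType.
Local Notation C := R[i].

Lemma geometric_tail (x : C) : `|x| < 1 ->
  (fun N => \sum_(m < N) x ^+ m.+1 : C^o) @ \oo --> (x / (1 - x) : C^o).
Proof.
move=> x1; apply: (@eq_ccvg _ (fun N => x * \sum_(m < N) x ^+ m)).
  by move=> N; rewrite mulr_sumr; apply: eq_bigr => m _; rewrite exprS.
by apply: cvgM; [exact: cvg_cst | exact: cvg_geometric_sum].
Qed.

Lemma sym_range_cvg (F : int -> C) (c x y a b l : C) : `|x| < 1 -> `|y| < 1 ->
  c + (a * (x / (1 - x)) + b * (y / (1 - y))) = l ->
  F 0 = c -> (forall m, F m.+1%:Z + F (- m.+1%:Z) = a * x ^+ m.+1 + b * y ^+ m.+1) ->
  (fun N => \sum_(k < (N + N).+1) F ((k : nat)%:Z - N%:Z) : C^o) @ \oo -->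
  (l : C^o).
Proof.
move=> x1 y1 <- F0 FE.
apply: (@eq_ccvg _ (fun N => c + (a * \sum_(m < N) x ^+ m.+1 + b * \sum_(m < N) y ^+ m.+1))).
  move=> N; rewrite sum_sym_range F0 !mulr_sumr -big_split; congr (_ + _).
  by apply: eq_bigr => m _; rewrite FE.
apply: cvgD; first exact: cvg_cst.
by apply: cvgD; apply: cvgM; do [exact: cvg_cst | exact: geometric_tail].
Qed.

Lemma one_sub_neq0 (x : C) : `|x| < 1 -> 1 - x != 0.
Proof.
by move=> x1; rewrite subr_eq0; apply: contraTneq x1 => <-; rewrite normr1 ltxx.
Qed.

Variables (tau u : C) (d e : int).
Hypotheses (tau0 : tau != 0) (tau1 : `|tau| < 1) (u1 : `|u| = 1) (d0 : 0 < d)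
  (de1 : d + e != 0) (de2 : d - e != 0).
(** Thus tau is a d-th root of t and |X| = |t|^x, while the hypotheses on d + e and d - e keep x
    away from the poles -1 and 1. *)
Let t := tau ^ d.
Let X := u * tau ^ e.
Let x : rat := e%:~R / d%:~R.

Lemma norm_exprz_lt1 k : 0 < k -> `|tau ^ k| < 1.
Proof.
by case: k => // k k0; rewrite -exprnP normrX expr_lt1.
Qed.

Let u0 : u != 0. Proof. exact: unit_norm_neq0. Qed.
Let X0 : X != 0. Proof. by rewrite mulf_neq0 // expfz_neq0. Qed.
Let t0 : t != 0. Proof. by rewrite expfz_neq0. Qed.

Let normtX : `|t * X| = `|tau ^ (d + e)|.
Proof. by rewrite /X mulrCA normrM u1 mul1r expfzDr. Qed.

Let normtX' : `|t / X| = `|tau ^ (d - e)|.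
Proof. by rewrite /X invfM mulrCA normrM normfV u1 invr1 mul1r expfzDr // invr_expz. Qed.

Let x_cases : [\/ [/\ -1 < x, x < 1, 0 < d + e & 0 < d - e], 1 < x /\ 0 < e - d | x < -1 /\ 0 < - d - e].
Proof.
have dq : 0 < d%:~R :> rat by rewrite ltr0z.
have [h|h] := ltP 0 (d + e); last first.
  apply: Or33; rewrite /x ltr_pdivrMr // mulN1r -rmorphN ltr_int; lia.
have [h'|h'] := ltP 0 (d - e); last first.
  apply: Or32; rewrite /x ltr_pdivlMr // mul1r ltr_int; lia.
apply: Or31; rewrite /x ltr_pdivlMr // ltr_pdivrMr // mulN1r mul1r -rmorphN !ltr_int; split; lia.
Qed.

(** The kernel is 1 / (1 - t X) + (t / X) / (1 - t / X). Past a pole, one of the two fractions is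
    expanded in the inverse ratio, with the opposite sign. *)
Lemma pkernel_series :
  (fun N => \sum_(k < (N + N).+1) pkernel t x ((k : nat)%:Z - N%:Z) *
      X ^ ((k : nat)%:Z - N%:Z) : C^o) @ \oo -->
  ((1 - t ^+ 2) / ((1 - t * X) * (1 - t * X^-1)) : C^o).
Proof.
case: x_cases => [[x1 x2 h1 h2]|[x1 h]|[x1 h]].
- have n1 : `|t * X| < 1 by rewrite normtX norm_exprz_lt1.
  have n2 : `|t / X| < 1 by rewrite normtX' norm_exprz_lt1.
  have XtN : X - t != 0.
    have -> : X - t = X * (1 - t / X) by field.
    by rewrite mulf_neq0 ?one_sub_neq0.
  apply: (@sym_range_cvg (fun m => pkernel t x m * X ^ m) 1 (t * X) (t / X) 1 1 _ n1 n2).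
  + by field; rewrite X0 XtN one_sub_neq0.
  + by rewrite (pkernel_mid _ _ x1 x2) expr0z mulr1.
  + move=> m; rewrite !(pkernel_mid _ _ x1 x2) abszN absz_nat !mul1r.
    by rewrite -invr_expz -!exprnP -exprVn -!exprMn.
- have n1 : `|t * X| < 1.
    by rewrite normtX norm_exprz_lt1 //; lia.
  have n2 : `|X / t| < 1.
    by rewrite -invf_div normfV normtX' -normfV invr_expz opprB norm_exprz_lt1.
  have XtN : X - t != 0.
    have -> : X - t = - t * (1 - X / t) by field.
    by rewrite mulf_neq0 ?oppr_eq0 ?one_sub_neq0.
  apply: (@sym_range_cvg (fun m => pkernel t x m * X ^ m) 0 (t * X) (X / t) 1 (-1) _ n1 n2).
  + field; rewrite X0 XtN one_sub_neq0 // t0 /=.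
    by rewrite -oppr_eq0 opprB.
  + by rewrite (pkernel_gt _ _ x1) lexx oppr0 subrr mul0r.
  + move=> m; rewrite !(pkernel_gt _ _ x1) /= mul0r addr0 mul1r mulN1r mulrBl.
    have VE (z : C) : z ^ (- m.+1%:Z) = z^-1 ^+ m.+1.
      by rewrite -invr_expz -exprnP exprVn.
    by rewrite (VE t) -!exprnP (exprMn _ t X) (exprMn _ X t^-1) [X ^+ _ * _]mulrC.
- have n1 : `|t / X| < 1.
    by rewrite normtX' norm_exprz_lt1 //; lia.
  have n2 : `|(t * X)^-1| < 1.
    by rewrite normfV normtX -normfV invr_expz norm_exprz_lt1 //; lia.
  have XtN : X - t != 0.
    have -> : X - t = X * (1 - t / X) by field.
    by rewrite mulf_neq0 ?one_sub_neq0.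
  have tXN : 1 - t * X != 0.
    have -> : 1 - t * X = - (t * X) * (1 - (t * X)^-1) by field; rewrite X0 t0.
    by apply: mulf_neq0; [rewrite oppr_eq0 mulf_neq0 | apply: one_sub_neq0].
  apply: (@sym_range_cvg (fun m => pkernel t x m * X ^ m) 0 (t / X) (t * X)^-1 1 (-1) _ n1 n2).
  + field; rewrite X0 XtN t0 tXN /= -oppr_eq0 opprB.
    exact: tXN.
  + by rewrite (pkernel_lt _ _ x1) lexx oppr0 subrr mul0r.
  + move=> m; rewrite !(pkernel_lt _ _ x1) /= mul0r add0r mul1r mulN1r opprK mulrBl.
    have VE (z : C) : z ^ (- m.+1%:Z) = z^-1 ^+ m.+1.
      by rewrite -invr_expz -exprnP exprVn.
    rewrite (VE t) (VE X) -exprnP.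
    by rewrite (invfM t X) (exprMn _ t X^-1) (exprMn _ t^-1 X^-1).
Qed.

(** Every ratio that occurs has modulus |tau|^k with an integer k > 0, hence at most |tau|; the
    constant 2 covers coefficients that are differences of two powers. *)
Lemma pkernel_bound m : `|pkernel t x m * X ^ m| <= 2 * `|tau| ^+ `|m|%N.
Proof.
have b (z : C) k j : `|z| = `|tau ^ k| -> 0 < k -> `|z ^+ j| <= `|tau| ^+ j.
  move=> zE k0; rewrite normrX zE; apply: lerXn2r; rewrite ?nnegrE ?normr_ge0 //.
  case: k k0 {zE} => // -[//|k] _; rewrite -exprnP normrX exprS ler_piMr ?normr_ge0 //.
  by rewrite exprn_ile1 ?normr_ge0 // ltW.
have half (y z : C) : 0 <= z -> y <= z -> y <= 2 * z.
  by move=> z0 yz; rewrite mulr2n mulrDl mul1r (le_trans yz) // lerDl.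
have two (y z w : C) : `|y| <= w -> `|z| <= w -> `|y - z| <= 2 * w.
  move=> yw zw; rewrite mulr2n mulrDl mul1r; apply: le_trans (ler_normB _ _) _.
  exact: lerD.
have tau_ge0 j : 0 <= `|tau| ^+ j by rewrite exprn_ge0.
have VE (z : C) j : z ^ (- j.+1%:Z) = z^-1 ^+ j.+1.
  by rewrite -invr_expz -exprnP exprVn.
have normXt : `|X / t| = `|tau ^ (e - d)|.
  by rewrite -invf_div normfV normtX' -normfV invr_expz opprB.
have normtXV : `|(t * X)^-1| = `|tau ^ (- d - e)|.
  by rewrite normfV normtX -normfV invr_expz opprD.
case: x_cases => [[x1 x2 h1 h2]|[x1 h]|[x1 h]].
- apply: half => //; rewrite (pkernel_mid _ _ x1 x2).
  case: m => j; first by rewrite -exprnP -exprMn; apply: b normtX h1.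
  rewrite NegzE VE abszN absz_nat -exprMn; exact: b normtX' h2.
- rewrite (pkernel_gt _ _ x1); case: m => j /=; last by rewrite mul0r normr0 mulr_ge0.
  rewrite mulrBl; apply: two; first by rewrite -!exprnP -exprMn; apply: (b _ _ _ normtX); lia.
  rewrite -invr_expz -!exprnP -exprVn -exprMn [t^-1 * X]mulrC; exact: b normXt h.
- rewrite (pkernel_lt _ _ x1); case: ifP => m0; last by rewrite mul0r normr0 mulr_ge0.
  have [j mE] : exists j, m = - (j : nat)%:Z by exists `|m|%N; lia.
  rewrite mE opprK abszN absz_nat mulrBl -!invr_expz -!exprnP -!exprVn -!exprMn.
  apply: two; first by apply: (b _ _ _ normtX'); lia.
  rewrite -(invfM t X); exact: b normtXV h.
Qed.

End PoissonSeries.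

(** Orthogonality of characters: if a root eta has eta^p != 1, multiplying by eta permutes the roots
    and multiplies the sum by eta^p. *)
Lemma roots_of_unity (R : realType) (d : int) : 0 < d ->
  exists rs : seq R[i], [/\ uniq rs, forall x, (x \in rs) = (x ^ d == 1) &
    forall p : int, \sum_(x <- rs) x ^ p = if (d %| p)%Z then d%:~R else 0].
Proof.
case: d => // N N0.
have [rs E] := closed_field_poly_normal ('X^N - 1 : {poly R[i]}).
rewrite (_ : lead_coef _ = 1) ?scale1r in E; last first.
  by rewrite lead_coefDl ?lead_coefXn // size_polyXn size_polyN size_poly1.
have szX r : (0 < r)%N -> size ('X^r - 1 : {poly R[i]}) = r.+1.
  by move=> r0; rewrite -polyC1 size_XnsubC.
have urs : uniq rs.
  rewrite -separable.separable_prod_XsubC -E.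
  by apply: cyclotomic.separable_Xn_sub_1; rewrite pnatr_eq0 -lt0n.
have rsE x : (x \in rs) = (x ^+ N == 1).
  by rewrite -root_prod_XsubC -E rootE !hornerE subr_eq0.
have szrs : size rs = N.
  by apply/eqP; rewrite -eqSS -(size_prod_XsubC rs id) -E szX.
have rs0 x : x \in rs -> x != 0.
  by rewrite rsE; apply: contraTneq => ->; rewrite expr0n (gtn_eqF (N0 : (0 < N)%N)) eq_sym oner_eq0.
exists rs; split=> // p.
have pE x : x \in rs -> x ^ p = x ^+ `|(p %% N)%Z|%N.
  move=> xr; rewrite {1}(divz_eq p N) expfzDr ?rs0 // [(p %/ N)%Z * _]mulrC -exprz_exp.
  have -> : x ^ N = 1 by move: xr; rewrite rsE -exprnP => /eqP.
  rewrite exp1rz mul1r exprnP; congr (_ ^ _).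
  by have := modz_ge0 p (d := N); lia.
case: ifPn => [/dvdzP[q pq]|Ndp].
  rewrite (eq_big_seq (fun=> 1)) => [|x xr]; last first.
    by rewrite pq mulrC -exprz_exp -exprnP; move: xr; rewrite rsE => /eqP ->; rewrite exp1rz.
  by rewrite big_const_seq count_predT szrs iter_addr_0.
(* Otherwise X^r - 1, with r = p mod N and 0 < r < N, would have N roots. *)
have [eta etar etap] : exists2 eta, eta \in rs & eta ^ p != 1.
  apply/hasP; rewrite -[has _ _]negbK -all_predC; apply/negP => /allP all1.
  pose r := `|(p %% N)%Z|%N.
  have r0 : (0 < r)%N.
    by rewrite /r absz_gt0; apply: contra Ndp => /eqP/dvdz_mod0P.
  have rN : (r < N)%N.
    have := ltz_pmod p (d := N); have := modz_ge0 p (d := N); rewrite /r; lia.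
  have := @max_poly_roots _ ('X^r - 1) rs; rewrite szX // szrs ltnNge rN /=.
  rewrite -size_poly_gt0 szX // => H; have := H isT; case/(_ _ urs)/negP => //.
  apply/allP => x xr; rewrite rootE !hornerE subr_eq0 -pE //.
  by have := all1 _ xr; rewrite /= negbK.
have S : eta ^ p * \sum_(x <- rs) x ^ p = \sum_(x <- rs) x ^ p.
  have inj : injective (fun x => eta * x) by apply: mulfI; exact: rs0.
  have perm : perm_eq (map (fun x => eta * x) rs) rs.
    apply: uniq_perm => //; first by rewrite map_inj_uniq.
    move=> x; apply/mapP/idP => [[y yr ->]|xr].
      by move: etar yr; rewrite !rsE exprMn => /eqP -> /eqP ->; rewrite mul1r.
    exists (eta^-1 * x); last by rewrite mulVKf ?rs0.
    by move: etar xr; rewrite !rsE exprMn exprVn => /eqP -> /eqP ->; rewrite invr1 mulr1.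
  rewrite mulr_sumr -[RHS](perm_big _ perm) /= big_map.
  by apply: eq_bigr => x _; rewrite expfzMl.
apply/eqP; have : (eta ^ p - 1) * \sum_(x <- rs) x ^ p == 0.
  by rewrite mulrBl mul1r S subrr eqxx.
by rewrite mulf_eq0 subr_eq0 (negPf etap) => /eqP ->.
Qed.

(** * Summation over the kernel *)

Section KernelBox.
Variables (n : nat) (A : 'M[int]_(2, n)) (i j : 'I_n).
Local Notation d := (minor A).
Hypotheses (ij : i != j) (dij : 0 < d i j).
Local Notation P := (fun k => (k != i) && (k != j)).

Definition free_sum (l : 'I_n) (m : 'I_n -> int) : int := \sum_(k | P k) m k * d l k.

Lemma minor_diag k : d k k = 0.
Proof. by rewrite /minor mulrC subrr. Qed.

Lemma sum_free_split (l : 'I_n) (g : 'I_n -> int) :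
  \sum_k d l k * g k = d l i * g i + (d l j * g j + free_sum l g).
Proof.
rewrite (bigD1 i) //= (bigD1 j) 1?eq_sym //=; congr (_ + (_ + _)).
by apply: eq_bigr => k _; rewrite mulrC.
Qed.

(** Cramer's rule: combining the two row equations with the entries of column i or j eliminates g_i
    or g_j, and nothing is lost since d i j is nonzero. *)
Lemma in_kernelP (g : {ffun 'I_n -> int}) : reflect
  (g i * d i j = free_sum j g /\ g j * d i j = - free_sum i g) (in_kernel A g).
Proof.
apply: (iffP forallP) => [gk|[gi gj]].
  have gk' l : \sum_k A l k * g k = 0 by apply/eqP; exact: gk.
  have := minor_ker i gk'; have := minor_ker j gk'; rewrite !sum_free_split !minor_diag.
  rewrite (minorC _ j i) !mul0r !add0r => h1 h2.
  by split; lia.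
have hi : \sum_k d i k * g k = 0.
  by rewrite sum_free_split minor_diag mul0r add0r mulrC gj addNr.
have hj : \sum_k d j k * g k = 0.
  by rewrite sum_free_split minor_diag minorC mul0r add0r mulNr mulrC gi addNr.
have split l : \sum_k d l k * g k =
    A 0 l * (\sum_k A 1 k * g k) - A 1 l * (\sum_k A 0 k * g k).
  by rewrite !mulr_sumr -sumrB; apply: eq_bigr => k _; rewrite /minor; ring.
move: hi hj; rewrite !split; set v := \sum_k A 1 k * g k; set u := \sum_k A 0 k * g k => hi hj.
have dN0 : d i j != 0 by rewrite gt_eqF.
have u0 : u = 0.
  apply: (mulfI dN0); rewrite mulr0 /minor.
  transitivity (A 0 j * (A 0 i * v - A 1 i * u) - A 0 i * (A 0 j * v - A 1 j * u)); first by ring.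
  by rewrite hi hj !mulr0 subrr.
have v0 : v = 0.
  apply: (mulfI dN0); rewrite mulr0 /minor.
  transitivity (A 1 j * (A 0 i * v - A 1 i * u) - A 1 i * (A 0 j * v - A 1 j * u)); first by ring.
  by rewrite hi hj !mulr0 subrr.
move=> l; case: l => [[|[|]]] //= lp; apply/eqP.
  by rewrite -[RHS]u0 /u; apply: eq_bigr => k _; congr (A _ _ * _); apply: val_inj.
by rewrite -[RHS]v0 /v; apply: eq_bigr => k _; congr (A _ _ * _); apply: val_inj.
Qed.

Definition box_coord N (phi : {ffun 'I_n -> 'I_(N + N).+1}) (k : 'I_n) : int :=
  (phi k : nat)%:Z - N%:Z.

Definition box_vec (m : 'I_n -> int) : {ffun 'I_n -> int} :=
  [ffun k => if k == i then (free_sum j m %/ d i j)%Z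
             else if k == j then - (free_sum i m %/ d i j)%Z else m k].

Definition integral (m : 'I_n -> int) : bool :=
  (d i j %| free_sum j m)%Z && (d i j %| free_sum i m)%Z.

(* The coordinates other than i and j determine a kernel vector. *)
Definition kernel_box N : seq {ffun 'I_n -> int} :=
  [seq box_vec (box_coord phi) | phi : {ffun 'I_n -> 'I_(N + N).+1} <-
     enum (pfamily (ord0 : 'I_(N + N).+1) P (fun=> predT)) & integral (box_coord phi)].

Lemma box_vec_free m k : P k -> box_vec m k = m k.
Proof. by rewrite ffunE => /andP[/negPf -> /negPf ->]. Qed.

Lemma free_sum_box_vec l m : free_sum l (box_vec m) = free_sum l m.
Proof. by apply: eq_bigr => k Pk; rewrite box_vec_free. Qed.

Lemma kernel_box_uniq N : uniq (kernel_box N).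
Proof.
rewrite map_inj_in_uniq; first by apply: filter_uniq; exact: enum_uniq.
move=> phi psi.
rewrite mem_filter mem_enum => /andP[_ /pfamilyP[s1 _]].
rewrite mem_filter mem_enum => /andP[_ /pfamilyP[s2 _]] /ffunP E.
apply/ffunP => k; have [Pk|NPk] := boolP (P k); last first.
  (* Families take the default [ord0] at i and j, so distinct families differ in a free
     coordinate. *)
  have out (f : {ffun 'I_n -> 'I_(N + N).+1}) :
      (ord0).-support f \subset P -> f k = ord0.
    by move=> /fintype.subsetP sf; apply/eqP; apply: contraNT NPk => fk; apply: (sf k).
  by rewrite !out.
have := E k; rewrite !box_vec_free // /box_coord => H.
by apply: val_inj => /=; lia.
Qed.

Lemma mem_kernel_box N (g : {ffun 'I_n -> int}) :
  (g \in kernel_box N) = in_kernel A g && [forall k, P k ==> (`|g k|%N <= N)%N].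
Proof.
apply/mapP/andP => [[phi + ->]|[/in_kernelP[gi gj] /forallP gN]].
  rewrite mem_filter => /andP[/andP[dj di] _]; split.
    apply/in_kernelP; rewrite !free_sum_box_vec !ffunE eqxx eq_sym (negPf ij) eqxx.
    by rewrite mulNr !divzK.
  apply/forallP => k; apply/implyP => Pk; rewrite box_vec_free // /box_coord.
  move: (ltn_ord (phi k)); move: (nat_of_ord (phi k)) => c cN; lia.
pose phi : {ffun 'I_n -> 'I_(N + N).+1} :=
  [ffun k => if P k then inord `|(g k + N%:Z)%R|%N else ord0].
have phiE k : P k -> box_coord phi k = g k.
  move=> Pk; have := gN k; rewrite Pk /= => gkN.
  by rewrite /box_coord ffunE Pk inordK; lia.
have fsE l : free_sum l (box_coord phi) = free_sum l g.
  by apply: eq_bigr => k Pk; rewrite phiE.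
have dN0 : d i j != 0 by rewrite gt_eqF.
have gj' : free_sum i g = (- g j) * d i j by rewrite mulNr gj opprK.
exists phi.
  rewrite mem_filter /integral !fsE -gi gj' !dvdz_mull //=.
  rewrite mem_enum; apply/pfamilyP; split=> //; apply/fintype.subsetP => k.
  by rewrite !inE ffunE; case: ifP; rewrite ?eqxx.
apply/ffunP => k; rewrite ffunE !fsE; case: (eqVneq k i) => [->|ki].
  by rewrite -gi mulzK.
case: (eqVneq k j) => [->|kj]; last by rewrite phiE // ki kj.
by rewrite gj' mulzK // opprK.
Qed.

Section BoxSum.
Variables (F : fieldType) (G : 'I_n -> int -> F).

(** By orthogonality the average over xi and zeta is the indicator of [integral]. The free sums are
    linear, so both characters split over the free coordinates and the sum over the box becomes a
    product of sums. *)
Lemma kernel_box_sum N (D : F) (rs : seq F) :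
  D != 0 -> (forall x, x \in rs -> x != 0) ->
  (forall p : int, \sum_(x <- rs) x ^ p = if (d i j %| p)%Z then D else 0) ->
  \sum_(g <- kernel_box N) \prod_(k | P k) G k (g k) =
  \sum_(xi <- rs) \sum_(zeta <- rs) (D ^+ 2)^-1 *
    \prod_(k | P k) \sum_(c < (N + N).+1)
      (G k ((c : nat)%:Z - N%:Z) * (xi ^ d i k * zeta ^ d j k) ^ ((c : nat)%:Z - N%:Z)).
Proof.
move=> D0 rs0 orth.
transitivity (\sum_(phi in pfamily (ord0 : 'I_(N + N).+1) P (fun=> predT))
   (integral (box_coord phi))%:R * \prod_(k | P k) G k (box_coord phi k)).
  rewrite big_map big_filter big_enum_cond big_mkcondr /=; apply: eq_bigr => phi _.
  case: ifP => _; last by rewrite mul0r.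
  by rewrite mul1r; apply: eq_bigr => k Pk; rewrite box_vec_free.
under [RHS]eq_bigr do under eq_bigr do rewrite (big_distr_big_dep (ord0 : 'I_(N + N).+1)) mulr_sumr.
under [RHS]eq_bigr do rewrite exchange_big.
rewrite [RHS]exchange_big /=; apply: eq_bigr => phi _.
have zpow (z : F) (a : 'I_n -> int) : z != 0 ->
    z ^ (\sum_(k | P k) a k) = \prod_(k | P k) z ^ a k.
  by move=> z0; apply: (big_morph (fun e => z ^ e)) => // x y; rewrite expfzDr.
transitivity (\sum_(xi <- rs) \sum_(zeta <- rs) (D ^+ 2)^-1 *
   ((\prod_(k | P k) G k (box_coord phi k)) *
    (xi ^ free_sum i (box_coord phi) * zeta ^ free_sum j (box_coord phi)))).
  rewrite (eq_bigr (fun xi => ((D ^+ 2)^-1 * \prod_(k | P k) G k (box_coord phi k)) *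
     (xi ^ free_sum i (box_coord phi) *
       \sum_(zeta <- rs) zeta ^ free_sum j (box_coord phi)))); last first.
    move=> xi _; rewrite !mulr_sumr; apply: eq_bigr => zeta _.
    exact: mulrA.
  rewrite -mulr_sumr -mulr_suml !orth /integral andbC.
  case: ifP => _ /=; last by rewrite !mul0r mulr0.
  case: ifP => _ /=; last by rewrite mul0r !mulr0.
  by rewrite mul1r mulrAC -expr2 mulVf ?mul1r // expf_neq0.
apply: eq_big_seq => xi /rs0 xi0; apply: eq_big_seq => zeta /rs0 zeta0.
rewrite big_split /=; congr (_ * (_ * _)).
rewrite /free_sum !zpow // -big_split /=; apply: eq_bigr => k _.
by rewrite expfzMl !exprz_exp ![d _ k * _]mulrC.
Qed.

End BoxSum.
End KernelBox.

Section ComplexPowers.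
Variable R : realType.
Local Notation C := R[i].

Lemma cexpD (a b : C) : cexp (a + b) = cexp a * cexp b.
Proof.
case: a b => [a1 a2] [b1 b2]; rewrite /cexp /= expRD cosD sinD.
by apply/eqP; rewrite eq_complex /=; apply/andP; split; apply/eqP; ring.
Qed.

Lemma cexp0 : cexp (0 : C) = 1.
Proof. by rewrite /cexp /= expR0 cos0 sin0 mul1r. Qed.

Lemma cexp_neq0 (z : C) : cexp z != 0.
Proof.
apply/eqP => E; have := cexpD z (- z).
by rewrite subrr cexp0 E mul0r => /eqP; rewrite oner_eq0.
Qed.

Lemma cexp_intmul (z : C) (m : int) : cexp (m%:~R * z) = cexp z ^ m.
Proof.
have cexp_natmul k : cexp (k%:R * z) = cexp z ^+ k.
  elim: k => [|k IH]; first by rewrite mul0r cexp0 expr0.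
  by rewrite -addn1 natrD mulrDl mul1r cexpD IH exprD expr1.
case: m => k; first exact: cexp_natmul.
rewrite NegzE mulrNz mulNr -invr_expz -exprnP -cexp_natmul.
apply: (mulIf (cexp_neq0 (k.+1%:R * z))).
by rewrite -cexpD addNr cexp0 mulVf // cexp_neq0.
Qed.

End ComplexPowers.

Lemma ccvg_sum (R : realType) (I : eqType) (r : seq I) (f : I -> nat -> R[i]^o)
    (l : I -> R[i]^o) : (forall x, x \in r -> f x @ \oo --> l x) ->
  (fun N => \sum_(x <- r) f x N : R[i]^o) @ \oo --> (\sum_(x <- r) l x : R[i]^o).
Proof.
elim: r => [_|x r IH fl].
  by rewrite big_nil; apply: (@eq_ccvg _ (fun=> 0)) (cvg_cst _) => N; rewrite big_nil.
rewrite big_cons; apply: (@eq_ccvg _ (fun N => f x N + \sum_(y <- r) f y N)).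
  by move=> N; rewrite big_cons.
apply: cvgD; first by apply: fl; rewrite mem_head.
by apply: IH => y yr; apply: fl; rewrite inE yr orbT.
Qed.

(** * The contribution of one pair of indices *)

Section TermLimit.
Variables (R : realType) (n : nat) (A : 'M[int]_(2, n)) (i j : 'I_n).
Local Notation C := R[i].
Local Notation d := (minor A).
Local Notation P := (fun k => (k != i) && (k != j)).
Variables (tau : C) (rs : seq C).
Hypotheses (ij : i != j) (dij : 0 < d i j) (tau0 : tau != 0) (tau1 : `|tau| < 1)
  (rsE : forall x, (x \in rs) = (x ^ d i j == 1))
  (orth : forall p : int, \sum_(x <- rs) x ^ p = if (d i j %| p)%Z then (d i j)%:~R else 0)
  (gen1 : forall k, P k -> d i j + (d i k + d j k) != 0)
  (gen2 : forall k, P k -> d i j - (d i k + d j k) != 0).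
Let t := tau ^ d i j.

Let pos k : rat := (d i k + d j k)%:~R / (d i j)%:~R.

(** The factor 1 is the unimodular number u of [pkernel_bound]. *)
Let summand (k : 'I_n) (m : int) : C :=
  pkernel t (pos k) m * (1 * tau ^ (d i k + d j k)) ^ m.

(** On the kernel, d_ij (g_i - g_j) is the sum of (d_ik + d_jk) g_k over the free k, so the power of
    t in front spreads over the free coordinates as powers of tau. *)
Lemma kernel_term (g : {ffun 'I_n -> int}) : in_kernel A g ->
  t ^ (g i - g j) * \prod_(k | P k) pkernel t (pos k) (g k) =
  \prod_(k | P k) summand k (g k).
Proof.
move=> /(in_kernelP ij dij)[gi gj]; rewrite big_split /= mulrC; congr (_ * _).
rewrite /t exprz_exp mulrC mulrBl gi gj opprK /free_sum -big_split /=.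
rewrite (big_morph (fun e => tau ^ e) (_ : {morph _ : x y / x + y >-> x * y}) (expr0z tau)).
  by apply: eq_bigr => k _; rewrite mul1r exprz_exp -mulrDr addrC mulrC.
by move=> x y; rewrite expfzDr.
Qed.

Lemma root_norm1 x : x \in rs -> `|x| = 1.
Proof.
rewrite rsE; case: (d i j) dij => // N N0; rewrite -exprnP => /eqP xN; apply/eqP.
by rewrite -(pexpr_eq1 (N0 : (0 < N)%N) (normr_ge0 x)) -normrX xN normr1.
Qed.

Lemma root_neq0 x : x \in rs -> x != 0.
Proof. by move=> /root_norm1; exact: unit_norm_neq0. Qed.

Let limit : C := \sum_(xi <- rs) \sum_(zeta <- rs) ((d i j)%:~R ^+ 2)^-1 *
  \prod_(k | P k) ((1 - t ^+ 2) /
    ((1 - t * ((xi ^ d i k * zeta ^ d j k) * tau ^ (d i k + d j k))) *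
     (1 - t * ((xi ^ d i k * zeta ^ d j k) * tau ^ (d i k + d j k))^-1))).

Lemma kernel_box_cvg :
  (fun N => \sum_(g <- kernel_box A i j N) \prod_(k | P k) summand k (g k) : C^o)
    @ \oo --> (limit : C^o).
Proof.
have DN0 : (d i j)%:~R != 0 :> C by rewrite intr_eq0 gt_eqF.
have merge (a b c : C) (m : int) : a * (1 * c) ^ m * b ^ m = a * (b * c) ^ m.
  by rewrite mul1r -mulrA -expfzMl [c * b]mulrC.
apply: (@eq_ccvg _ (fun N => \sum_(xi <- rs) \sum_(zeta <- rs) ((d i j)%:~R ^+ 2)^-1 *
  \prod_(k | P k) \sum_(c < (N + N).+1) (pkernel t (pos k) ((c : nat)%:Z - N%:Z) *
    ((xi ^ d i k * zeta ^ d j k) * tau ^ (d i k + d j k)) ^ ((c : nat)%:Z - N%:Z)))).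
  move=> N; rewrite (kernel_box_sum summand N DN0 root_neq0 orth).
  apply: eq_bigr => xi _; apply: eq_bigr => zeta _; congr (_ * _).
  apply: eq_bigr => k _; apply: eq_bigr => c _.
  exact/esym/merge.
apply: ccvg_sum => xi xir; apply: ccvg_sum => zeta zr; apply: cvgM; first exact: cvg_cst.
apply: cvg_big; first exact: mul_continuous.
move=> k Pk; apply: pkernel_series => //.
- by rewrite normrM !normr_unit_exprz ?mulr1 ?root_norm1.
- exact: gen1.
- exact: gen2.
Qed.

(** Boxes depend on (i, j) and balls do not; only over balls can the limits for different pairs be
    added. *)
Lemma kernel_ball_cvg :
  (fun N => \sum_(g <- kernel_ball A N)
     t ^ (g i - g j) * \prod_(k | P k) pkernel t (pos k) (g k) : C^o)
    @ \oo --> (limit : C^o).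
Proof.
apply: (@eq_ccvg _ (fun N => \sum_(g <- kernel_ball A N) \prod_(k | P k) summand k (g k))).
  move=> N; rewrite big_seq [RHS]big_seq; apply: eq_bigr => g.
  by rewrite mem_kernel_ball => /andP[gk _]; rewrite kernel_term.
pose r := complex.Re `|tau|.
have rE : `|tau| = r%:C by rewrite [LHS]norm_realE.
have r0 : 0 <= r by rewrite -lecR -rE; exact: normr_ge0.
have r1 : r < 1 by rewrite -ltcR -rE.
have r1' : 0 < 1 - r by rewrite subr_gt0.
pose G (g : {ffun 'I_n -> int}) := \prod_(k | P k) (2 * r ^+ `|g k|%N).
(* The bound comes from sum_m r^|m| <= 1 + 2 / (1 - r), one factor per free coordinate. *)
apply: (@exhaustion_cvg _ _ _ G (kernel_box A i j) _ _
    (\prod_(k | P k) (2 * (1 + 2 / (1 - r))))).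
- move=> g; rewrite normr_prod rmorph_prod; apply: ler_prod => k Pk.
  rewrite normr_ge0 /= rmorphM rmorphXn rmorph_nat /= -rE.
  by apply: pkernel_bound => //; rewrite ?normr1 ?gen1 ?gen2.
- exact: kernel_box_uniq.
- exact: kernel_ball_uniq.
- move=> N M NM g; rewrite !mem_kernel_box // => /andP[-> /forallP gN].
  apply/forallP => k; apply/implyP => Pk; apply: leq_trans NM.
  by have := gN k; rewrite Pk.
- move=> N M NM g; rewrite !mem_kernel_ball => /andP[-> gN].
  exact: leq_trans NM.
- move=> N; exists (\sum_(g <- kernel_box A i j N) norm1 g).+1 => g gN.
  rewrite mem_kernel_ball; move: (gN); rewrite mem_kernel_box // => /andP[-> _].
  by rewrite ltnS (big_rem g) //= leq_addr.
- move=> N; exists N => g; rewrite mem_kernel_ball mem_kernel_box // => /andP[-> gN].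
  apply/forallP => k; apply/implyP => _; apply: leq_trans (ltnW gN).
  by rewrite /norm1 (bigD1 k) //= leq_addr.
(* Dropping the integrality condition only enlarges the sum of majorants, which then factors over
   the free coordinates. *)
- move=> N; rewrite /kernel_box big_map big_filter big_enum_cond big_mkcondr /=.
  apply: (@le_trans _ _ (\sum_(phi in pfamily (ord0 : 'I_(N + N).+1) P (fun=> predT))
      \prod_(k | P k) (2 * r ^+ `|box_coord phi k|%N))).
    apply: ler_sum => phi _; have ge0 : 0 <= \prod_(k | P k) (2 * r ^+ `|box_coord phi k|%N).
      by apply: prodr_ge0 => k _; rewrite mulr_ge0 ?exprn_ge0.
    case: ifP => // _.
    rewrite (_ : \prod_(k | P k) (2 * r ^+ `|box_coord phi k|%N) = G (box_vec A i j (box_coord phi))) //.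
    by apply: eq_bigr => k Pk; rewrite box_vec_free.
  rewrite -(big_distr_big_dep (ord0 : 'I_(N + N).+1) P (fun _ _ => true)
    (fun k c => 2 * r ^+ `|(c : nat)%:Z - N%:Z|%N)).
  apply: ler_prod => k _; rewrite sumr_ge0 => [|c _]; last by rewrite mulr_ge0 ?exprn_ge0.
  rewrite -mulr_sumr ler_pM2l // (sum_sym_range (fun m => r ^+ `|m|%N)) expr0 lerD2l.
  rewrite (eq_bigr (fun m : 'I_N => 2 * (r * r ^+ m))) => [|m _]; last first.
    by rewrite abszN absz_nat exprS; ring.
  rewrite -!mulr_sumr ler_pM2l // -[(1 - r)^-1]mul1r ler_pdivlMr //.
  have : (1 - r) * \sum_(m < N) r ^+ m <= 1.
    by rewrite -opprB mulNr -subrX1 opprB lerBlDr lerDl exprn_ge0.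
  have : 0 <= (1 - r) * \sum_(m < N) r ^+ m.
    apply: mulr_ge0; first exact: ltW.
    by apply: sumr_ge0 => m _; rewrite exprn_ge0.
  rewrite mulrAC -mulrA; move: (_ * \sum_(m < N) _) => S h1 h2.
  by apply: le_trans h2; rewrite ler_piMl // ltW.
- exact: kernel_box_cvg.
Qed.

End TermLimit.

(** * Assembly of the formula *)

Lemma card_excluding2 n (i j : 'I_n) : i != j ->
  #|[pred k | (k != i) && (k != j)]| = (n - 2)%N.
Proof.
move=> ij; have := cardC (pred2 i j); rewrite card2 ij card_ord => nE.
rewrite (@eq_card _ _ [predC pred2 i j]) => [|k]; last by rewrite !inE negb_or.
by move: nE; set c := #|_|; move=> nE; lia.
Qed.

(** The orderings (i, j, k) and (j, i, k) of the generic condition keep the position (d_ik + d_jk) /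
    d_ij away from -1 and 1 respectively. *)
Lemma generic_factors n (A : 'M[int]_(2, n)) i j k : generic A -> i != j ->
  (k != i) && (k != j) ->
  minor A i j + (minor A i k + minor A j k) != 0 /\
  minor A i j - (minor A i k + minor A j k) != 0.
Proof.
move=> [_ _ gen] ij /andP[ki kj]; have ik : i != k by rewrite eq_sym.
have jk : j != k by rewrite eq_sym.
have ji : j != i by rewrite eq_sym.
have h1 := gen i j k ij ik jk; have h2 := gen j i k ji jk ik.
have h3 := minorC A i j.
by split; lia.
Qed.

Theorem theorem3p1 (R : realType) (n : nat) (A : 'M[int]_(2, n))
    (t logt : R[i]) :
  (2 < n)%N -> faithful A -> completely_generic A ->
  0 < `|t| -> `|t| < 1 -> cexp logt = t ->
  let d := minor A in
  series (fun m : nat => (hilb_on R A m)%:R * t ^+ m : R[i]^o) @ \oo -->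
  (\sum_(i < n) \sum_(j < n | (i != j) && (0 < d i j))
     \sum_(xi \in [set xi : R[i] | xi ^ d i j = 1])
     \sum_(zeta \in [set zeta : R[i] | zeta ^ d i j = 1])
       ((d i j)%:~R ^+ 2 *
        \prod_(k < n | (k != i) && (k != j))
          ((1 - xi ^ d i k * zeta ^ d j k
                * cpow_frac logt (d i j + d i k + d j k) (d i j)) *
           (1 - xi ^ (- d i k) * zeta ^ (- d j k)
                * cpow_frac logt (d i j - d i k - d j k) (d i j))))^-1 : R[i]^o).
Proof.
move=> n2 fA gA t0 t1 logtE d.
have [[st inj gen1] gen2] := gA.
have tN0 : t != 0 by rewrite -normr_gt0.
have u0 : 1 - t ^+ 2 != 0 by rewrite one_sub_neq0 // normrX expr_lt1.
pose term i j : R[i] := \sum_(xi \in [set xi : R[i] | xi ^ d i j = 1])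
     \sum_(zeta \in [set zeta : R[i] | zeta ^ d i j = 1])
       ((d i j)%:~R ^+ 2 *
        \prod_(k < n | (k != i) && (k != j))
          ((1 - xi ^ d i k * zeta ^ d j k
                * cpow_frac logt (d i j + d i k + d j k) (d i j)) *
           (1 - xi ^ (- d i k) * zeta ^ (- d j k)
                * cpow_frac logt (d i j - d i k - d j k) (d i j))))^-1.
have term_cvg i j : i != j -> 0 < d i j ->
    (fun N => \sum_(g <- kernel_ball A N) t ^ (g i - g j) *
       \prod_(k | (k != i) && (k != j))
         pkernel t ((d i k + d j k)%:~R / (d i j)%:~R) (g k) : R[i]^o) @ \oo -->
    (term i j * (1 - t ^+ 2) ^+ (n - 2) : R[i]^o).
  move=> ij dij.
  have dq0 : (d i j)%:~R != 0 :> R[i] by rewrite intr_eq0 gt_eqF.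
  (* The d_ij-th root of t singled out by [logt]; all fractional powers in this term are its integer
     powers. *)
  pose tau := cexp ((d i j)%:~R^-1 * logt).
  have tauE m : cpow_frac logt m (d i j) = tau ^ m.
    by rewrite /cpow_frac -mulrA cexp_intmul.
  have tE : t = tau ^ d i j.
    by rewrite -tauE /cpow_frac divff // mul1r logtE.
  have tau0 : tau != 0 by exact: cexp_neq0.
  have tau1 : `|tau| < 1.
    move: t1; rewrite tE; case: (d i j) dij => // N N0.
    by rewrite -exprnP normrX expr_lt1 ?normr_ge0.
  have [rs [urs rsE orth]] := roots_of_unity R dij.
  have setE : [set xi : R[i] | xi ^ d i j = 1] = [set` rs].
    by apply/seteqP; split=> x /=; rewrite rsE => /eqP.
  have cond k : (k != i) && (k != j) ->
      d i j + (d i k + d j k) != 0 /\ d i j - (d i k + d j k) != 0.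
    by apply: generic_factors => //; case: gA.
  have H := @kernel_ball_cvg R n A i j tau rs ij dij tau0 tau1 rsE orth
    (fun k Pk => (cond k Pk).1) (fun k Pk => (cond k Pk).2).
  rewrite -/d -tE in H; apply: ccvg_lim_eq H.
  rewrite /term setE -fsbig_seq // mulr_suml; apply: eq_big_seq => xi xir.
  rewrite -fsbig_seq // mulr_suml; apply: eq_big_seq => zeta zr.
  (* One factor for each of the n - 2 Poisson kernels, whose numerator it matches. *)
  rewrite (_ : (1 - t ^+ 2) ^+ (n - 2) = \prod_(k < n | (k != i) && (k != j)) (1 - t ^+ 2)); last first.
    by rewrite -(card_excluding2 ij) prodr_const.
  rewrite (invfM (_ ^+ 2)) -[RHS]mulrA; congr (_ * _).
  rewrite -prodfV -big_split /=; apply: eq_bigr => k _.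
  rewrite mulrC; congr (_^-1 * _).
  have xi0 := root_neq0 dij rsE xir; have z0 := root_neq0 dij rsE zr.
  have e1 : tau ^ (d i j + d i k + d j k) = t * tau ^ (d i k + d j k).
    by rewrite -addrA expfzDr // -tE.
  have e2 : tau ^ (d i j - d i k - d j k) = t / tau ^ (d i k + d j k).
    by rewrite -addrA -opprD expfzDr // -tE invr_expz.
  rewrite !tauE e1 e2 -!invr_expz; congr ((1 - _) * (1 - _)); first exact: mulrCA.
  by rewrite !invfM mulrCA.
have K : (fun N => \sum_(g <- kernel_ball A N) t ^+ norm1 g : R[i]^o) @ \oo -->
   ((\sum_(i < n) \sum_(j < n | (i != j) && (0 < d i j)) term i j) *
      (1 - t ^+ 2) ^+ (n - 2) : R[i]^o).
  apply: (@eq_ccvg _ (fun N => \sum_i \sum_(j | (i != j) && (0 < d i j))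
      \sum_(g <- kernel_ball A N) t ^ (g i - g j) * \prod_(k | (k != i) && (k != j))
         pkernel t ((d i k + d j k)%:~R / (d i j)%:~R) (g k))).
    move=> N; under eq_bigr do rewrite exchange_big /=.
    rewrite exchange_big big_seq [RHS]big_seq; apply: eq_bigr => g.
    rewrite mem_kernel_ball => /andP[/forallP gk _]; rewrite /norm1.
    rewrite (pkernel_expansion tN0 fA gA) //; first by move=> i; exact/eqP.
    exact: ltnW (ltnW n2).
  rewrite mulr_suml; apply: cvg_big; first exact: add_continuous.
  move=> i _; rewrite mulr_suml; apply: cvg_big; first exact: add_continuous.
  by move=> j /andP[ij dij]; exact: term_cvg.
have H := hilbert_series (ltnW n2) fA st t1 K.
apply: (@eq_ccvg _ (fun N => \sum_(m < N) (hilb_on R A m)%:R * t ^+ m)) H => N.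
by rewrite /series /= big_mkord.
Qed.
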